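(* Let $V^n$ be a complex vector space of finite dimension $n$ and let $\|\cdot\|$ be any norm on $V^n$. Then the space $\mathrm{Hol}(\mathbb{C}^*,V^n)$ of holomorphic maps $\mathbb{C}^*\to V^n$, equipped with the family of norms $$\|f\|_k:=\sup_{z\in A_k}\|f(z)\|,\qquad k\in\mathbb{N}_0,$$ is a tame Fréchet space.
   Context: For $k\in\mathbb{N}_0$, $A_k:=\{z\in\mathbb{C}^*\mid e^{-k}\le |z|\le e^k\}$ (so $A_0=S^1$). A graded Fréchet space is a Fréchet space together with a sequence of seminorms $\|\cdot\|_0\le\|\cdot\|_1\le\|\cdot\|_2\le\dots$ defining its topology. A linear map $\varphi:F\to G$ between graded Fréchet spaces is tame if there are $r,b\in\mathbb{N}_0$ and constants $C(n)>0$ with $\|\varphi(f)\|_n\le C(n)\|f\|_{n+r}$ for all $f\in F$ and $n\ge b$. For a Banach space $B$, $\Sigma(B)$ denotes the space of exponentially decreasing sequences $(f_k)_{k\in\mathbb{N}_0}$ in $B$, i.e. those with $\sum_k e^{nk}\|f_k\|_B<\infty$ for all $n$, graded by the norms $\|f\|_{l_1^n}=\sum_k e^{nk}\|f_k\|_B$. A graded Fréchet space $F$ is a tame Fréchet space if there are a Banach space $B$ and tame linear maps $\varphi:F\to\Sigma(B)$, $\psi:\Sigma(B)\to F$ with $\psi\circ\varphi=\mathrm{id}_F$. *)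

(* Defs.v *)
From Stdlib Require Import Reals Lra ProofIrrelevance FunctionalExtensionality.
From Coquelicot Require Import Coquelicot.

Open Scope R_scope.

Record subspace_closed {K : Ring} {T : Type} {V : ModuleSpace K}
    (P : (T -> V) -> Prop) : Prop := {
  closed_zero : P (fun _ => zero);
  closed_plus : forall f g, P f -> P g -> P (fun t => plus (f t) (g t));
  closed_scal : forall (a : K) f, P f -> P (fun t => scal a (f t))
}.

Section FunSpace.
Context {K : Ring} {T : Type} {V : ModuleSpace K}.
Context (P : (T -> V) -> Prop) (HP : subspace_closed P).

Definition fs_car : Type := {f : T -> V | P f}.

Definition fs_zero : fs_car := exist P _ (closed_zero P HP).
Definition fs_plus (f g : fs_car) : fs_car :=
  exist P _ (closed_plus P HP _ _ (proj2_sig f) (proj2_sig g)).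
Definition fs_scal (a : K) (f : fs_car) : fs_car :=
  exist P _ (closed_scal P HP a _ (proj2_sig f)).
Definition fs_opp : fs_car -> fs_car := fs_scal (opp one).

Lemma fs_ext (f g : fs_car) :
  (forall t, proj1_sig f t = proj1_sig g t) -> f = g.
Proof.
destruct f as [f Hf], g as [g Hg]; simpl; intros E.
apply functional_extensionality in E; subst g.
f_equal; apply proof_irrelevance.
Qed.

Lemma fs_plus_comm f g : fs_plus f g = fs_plus g f.
Proof. apply fs_ext; intros t; apply plus_comm. Qed.

Lemma fs_plus_assoc f g h : fs_plus f (fs_plus g h) = fs_plus (fs_plus f g) h.
Proof. apply fs_ext; intros t; apply plus_assoc. Qed.

Lemma fs_plus_zero_r f : fs_plus f fs_zero = f.
Proof. apply fs_ext; intros t; apply plus_zero_r. Qed.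

Lemma fs_plus_opp_r f : fs_plus f (fs_opp f) = fs_zero.
Proof.
apply fs_ext; intros t; simpl.
rewrite scal_opp_one; apply (@plus_opp_r V).
Qed.

Definition fs_AbelianMonoid : AbelianMonoid :=
  AbelianMonoid.Pack fs_car
    (AbelianMonoid.Mixin fs_car fs_plus fs_zero
       fs_plus_comm fs_plus_assoc fs_plus_zero_r) fs_car.

Definition fs_AbelianGroup : AbelianGroup :=
  AbelianGroup.Pack fs_car
    (AbelianGroup.Class fs_car
       (AbelianMonoid.Mixin fs_car fs_plus fs_zero
          fs_plus_comm fs_plus_assoc fs_plus_zero_r)
       (AbelianGroup.Mixin fs_AbelianMonoid fs_opp fs_plus_opp_r)) fs_car.

Lemma fs_scal_assoc (a b : K) f : fs_scal a (fs_scal b f) = fs_scal (mult a b) f.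
Proof. apply fs_ext; intros t; apply scal_assoc. Qed.

Lemma fs_scal_one f : fs_scal one f = f.
Proof. apply fs_ext; intros t; apply scal_one. Qed.

Lemma fs_scal_distr_l (a : K) f g :
  fs_scal a (fs_plus f g) = fs_plus (fs_scal a f) (fs_scal a g).
Proof. apply fs_ext; intros t; apply (scal_distr_l a). Qed.

Lemma fs_scal_distr_r (a b : K) f :
  fs_scal (plus a b) f = fs_plus (fs_scal a f) (fs_scal b f).
Proof. apply fs_ext; intros t; apply (scal_distr_r a b). Qed.

Definition fs_ModuleSpace : ModuleSpace K :=
  ModuleSpace.Pack K fs_car
    (ModuleSpace.Class K fs_car (AbelianGroup.class fs_AbelianGroup)
       (ModuleSpace.Mixin K fs_AbelianGroup fs_scal
          fs_scal_assoc fs_scal_one fs_scal_distr_l fs_scal_distr_r)) fs_car.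

End FunSpace.

Definition is_seminorm {F : ModuleSpace C_AbsRing} (p : F -> R) : Prop :=
  (forall x, 0 <= p x) /\
  (forall x y, p (plus x y) <= p x + p y) /\
  (forall (a : C) x, p (scal a x) = Cmod a * p x).

Definition is_norm {F : ModuleSpace C_AbsRing} (p : F -> R) : Prop :=
  is_seminorm p /\ (forall x, p x = 0 -> x = zero).

(** A complex vector space with a sequence of real functions on it, considered
    with the topology which these functions generate. *)
Record GradedSpace : Type := {
  gs_space :> ModuleSpace C_AbsRing;
  gs_norm : nat -> gs_space -> R
}.

(** The topology generated by countably many seminorms is metrizable once it is
    separated, so that completeness is sequential completeness. *)
Record graded_frechet (F : GradedSpace) : Prop := {
  gf_seminorm : forall n, is_seminorm (gs_norm F n);
  gf_increasing : forall n (x : F), gs_norm F n x <= gs_norm F (S n) x;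
  gf_separated : forall x : F, (forall n, gs_norm F n x = 0) -> x = zero;
  gf_complete : forall u : nat -> F,
    (forall n eps, 0 < eps -> exists N : nat, forall i j : nat,
       (N <= i)%nat -> (N <= j)%nat -> gs_norm F n (minus (u i) (u j)) < eps) ->
    exists l : F, forall n,
      is_lim_seq (fun i => gs_norm F n (minus (u i) l)) 0
}.

Definition linear_map {F G : ModuleSpace C_AbsRing} (phi : F -> G) : Prop :=
  (forall x y, phi (plus x y) = plus (phi x) (phi y)) /\
  (forall (a : C) x, phi (scal a x) = scal a (phi x)).

Definition tame_linear {F G : GradedSpace} (phi : F -> G) : Prop :=
  linear_map phi /\
  exists (r b : nat) (c : nat -> R),
    (forall n, 0 < c n) /\
    (forall (n : nat) (x : F), (b <= n)%nat ->
       gs_norm G n (phi x) <= c n * gs_norm F (n + r) x).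

Definition exp_weight {B : NormedModule C_AbsRing} (n : nat) (f : nat -> B)
    (k : nat) : R :=
  exp (INR n * INR k) * norm (f k).

Definition exp_decreasing {B : NormedModule C_AbsRing} (f : nat -> B) : Prop :=
  forall n, ex_series (exp_weight n f).

Lemma exp_decreasing_closed (B : NormedModule C_AbsRing) :
  subspace_closed (@exp_decreasing B).
Proof.
split.
- intros n; apply (ex_series_ext (fun _ => 0)).
  + intros k; unfold exp_weight; symmetry.
    apply Rmult_eq_0_compat_l; exact (@norm_zero _ B).
  + exists 0; apply (filterlim_ext (fun _ => 0)).
    * intros k; symmetry; rewrite sum_n_const; apply Rmult_0_r.
    * apply filterlim_const.
- intros f g Hf Hg n.
  apply (@ex_series_le R_AbsRing R_CompleteNormedModule _
           (fun k => plus (exp_weight n f k) (exp_weight n g k))).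
  + intros k; unfold exp_weight.
    change (Rabs (exp (INR n * INR k) * norm (plus (f k) (g k))) <=
      exp (INR n * INR k) * norm (f k) + exp (INR n * INR k) * norm (g k)).
    rewrite Rabs_pos_eq, <- Rmult_plus_distr_l.
    * apply Rmult_le_compat_l; [left; apply exp_pos | apply norm_triangle].
    * apply Rmult_le_pos; [left; apply exp_pos | apply norm_ge_0].
  + apply (@ex_series_plus R_AbsRing R_NormedModule); auto.
- intros a f Hf n.
  apply (@ex_series_le R_AbsRing R_CompleteNormedModule _
           (fun k => Cmod a * exp_weight n f k)).
  + intros k; unfold exp_weight.
    change (Rabs (exp (INR n * INR k) * norm (scal a (f k))) <=
      Cmod a * (exp (INR n * INR k) * norm (f k))).
    rewrite Rabs_pos_eq.
    * replace (Cmod a * (exp (INR n * INR k) * norm (f k)))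
        with (exp (INR n * INR k) * (Cmod a * norm (f k))) by ring.
      apply Rmult_le_compat_l; [left; apply exp_pos | ].
      exact (norm_scal a (f k)).
    * apply Rmult_le_pos; [left; apply exp_pos | apply norm_ge_0].
  + exact (@ex_series_scal R_AbsRing R_NormedModule (Cmod a) _ (Hf n)).
Qed.

Definition Sigma (B : NormedModule C_AbsRing) : GradedSpace := {|
  gs_space := fs_ModuleSpace exp_decreasing (exp_decreasing_closed B);
  gs_norm n f := Series (exp_weight n (proj1_sig f))
|}.

Definition tame_frechet (F : GradedSpace) : Prop :=
  graded_frechet F /\
  exists (B : CompleteNormedModule C_AbsRing)
         (phi : F -> Sigma B) (psi : Sigma B -> F),
    tame_linear phi /\ tame_linear psi /\ (forall f, psi (phi f) = f).

Definition Cstar : Type := {z : C | z <> RtoC 0}.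

(** Complex differentiability at a nonzero point does not depend on the value
    given to the map at 0. *)
Definition extend0 {V : NormedModule C_AbsRing} (f : Cstar -> V) (z : C) : V :=
  match Ceq_dec z (RtoC 0) with
  | left _ => zero
  | right Hz => f (exist _ z Hz)
  end.

Definition holomorphic {V : NormedModule C_AbsRing} (f : Cstar -> V) : Prop :=
  forall z : Cstar, @ex_derive C_AbsRing V (extend0 f) (proj1_sig z).

Lemma holomorphic_closed (V : NormedModule C_AbsRing) :
  subspace_closed (@holomorphic V).
Proof.
split.
- intros z; apply (@ex_derive_ext C_AbsRing V (fun _ => zero)).
  + intros t; unfold extend0; destruct Ceq_dec; reflexivity.
  + apply ex_derive_const.
- intros f g Hf Hg z.
  apply (@ex_derive_ext C_AbsRing V (fun t => plus (extend0 f t) (extend0 g t))).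
  + intros t; unfold extend0; destruct Ceq_dec; [apply plus_zero_r | reflexivity].
  + apply @ex_derive_plus; auto.
- intros a f Hf z.
  apply (@ex_derive_ext C_AbsRing V (fun t => scal (a : C_AbsRing) (extend0 f t))).
  + intros t; unfold extend0; destruct Ceq_dec; [apply (@scal_zero_r _ V) | reflexivity].
  + destruct (Hf z) as [l Hl].
    exists (scal (a : C_AbsRing) l).
    apply (filterdiff_ext_lin _ (fun y : C_AbsRing => scal (a : C_AbsRing) (scal y l))).
    * apply filterdiff_scal_r_fct; [exact Cmult_comm | exact Hl].
    * intros y; rewrite !scal_assoc; f_equal; apply Cmult_comm.
Qed.

Definition annulus (k : nat) (z : C) : Prop :=
  exp (- INR k) <= Cmod z <= exp (INR k).

(** The supremum of the norm over the annulus; it is finite, since the annulus is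
    compact and holomorphic maps are continuous. *)
Definition sup_norm {V : NormedModule C_AbsRing} (k : nat) (f : Cstar -> V) : R :=
  real (Lub_Rbar (fun x => exists z : Cstar,
                    annulus k (proj1_sig z) /\ x = norm (f z))).

Definition Hol (V : NormedModule C_AbsRing) : GradedSpace := {|
  gs_space := fs_ModuleSpace holomorphic (holomorphic_closed V);
  gs_norm k f := sup_norm k (proj1_sig f)
|}.

(** The vectors [e 1], ..., [e n] form a basis; [sum_n_m _ 1 n] is [zero] when
    [n] is 0. *)
Definition is_basis {V : ModuleSpace C_AbsRing} (n : nat) (e : nat -> V) : Prop :=
  (forall v : V, exists a : nat -> C,
     v = sum_n_m (fun i => scal (a i : C_AbsRing) (e i)) 1 n) /\
  (forall a : nat -> C,
     sum_n_m (fun i => scal (a i : C_AbsRing) (e i)) 1 n = zero ->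
     forall i, (1 <= i <= n)%nat -> a i = RtoC 0).

Definition has_dim (V : ModuleSpace C_AbsRing) (n : nat) : Prop :=
  exists e : nat -> V, is_basis n e.

(* Main.v *)
Require Import Defs.
From Stdlib Require Import Reals Lra Lia ZArith.
From Stdlib Require Import ClassicalEpsilon FunctionalExtensionality PropExtensionality.
From Coquelicot Require Import Coquelicot.

(** A holomorphic map on the punctured plane is the sum of its Laurent series,
    and this identifies [Hol V] with a complemented subspace of a space of
    exponentially decreasing sequences. Take [B = V * V], send [f] to the sequence
    of pairs of coefficients (a_k, a_{-k}) ([analysis]), and send a sequence of
    pairs (b_k, c_k) to the map with value sum_k b_k z^k + sum_k c_k z^{-k} at [z]
    ([synth]). Synthesis after analysis is the identity ([synth_analysis]).

    Both maps are tame. On the annulus with bounds e^{-n} and e^n the powers z^k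
    and z^{-k} are at most e^{nk}, so that synthesis is bounded with constant 2 and
    no loss ([synth_shift]). For analysis, Cauchy's estimate on the circles of
    radius e^{n+1} and e^{-n-1} bounds the k-th pair by a constant times
    e^{-(n+1)k} ||f||_{n+1}; with the weight e^{nk} there remains a geometric series,
    and one degree is lost ([analysis_shift]).

    The other properties of [Hol V] come from the same two maps. Since f is the
    synthesis of its coefficients, it is bounded on every annulus, and so the
    suprema are true ones ([hol_bounded]). Cauchy's estimate on the unit circle
    alone makes already the smallest seminorm a norm ([sup_norm_eq_0]). Sequences
    with values in a complete space are complete ([Sigma_complete]), and a retract
    of a complete space is complete ([retract_complete]), which replaces the
    theorem on locally uniform limits of holomorphic maps.

    The Laurent expansion is first proved for scalar functions, from complex
    differentiability alone. In the coordinate w with z = e^w the coefficient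
    of index n on the circle |z| = e^x is the integral of the entire function
    g(e^w) e^{-nw} along a vertical segment of length 2 pi. This function has period
    2 pi i, so Goursat's theorem for rectangles ([goursat]) shows that the integral
    does not depend on x ([fourier_int_invariant]); estimating it on a suitable
    circle gives Cauchy's estimate ([laurent_bound]). For convergence at z = 1,
    write g(z) = g(1) + (z - 1) q(z) with q continuous. The Fourier coefficients of g
    are then g(1), at index 0, plus differences of consecutive coefficients of q;
    the partial sums telescope, and what remains tends to 0 by the Riemann-Lebesgue
    lemma ([laurent_sum_1]). Dilations carry this to every other point.

    A space of finite dimension is reached through coordinates, which are bounded
    functionals because all norms on it are equivalent ([coord_bound]). *)

Open Scope R_scope.

(** * Complex derivatives and the exponential function *)

(** The complex line with the uniform structure of the modulus, which is the one that
    the derivative of a map on the complex numbers refers to; the structure found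
    by default on pairs of real numbers has squares as balls. *)
Notation CN := (AbsRing_NormedModule C_AbsRing).

Lemma is_derive_C_eps {V : NormedModule C_AbsRing} (f : C -> V) (z : C) (l : V) :
  @is_derive C_AbsRing V f z l <->
  forall eps, 0 < eps -> exists delta, 0 < delta /\
    forall w : C, Cmod (w - z) < delta ->
      norm (minus (minus (f w) (f z)) (scal (w - z : C_AbsRing)%C l))
        <= eps * Cmod (w - z).
Proof.
split.
- intros [_ H] eps Heps.
  destruct (H z (fun P HP => HP) (mkposreal eps Heps)) as [d Hd].
  exists d; split; [apply cond_pos |].
  intros w Hw; apply (Hd w Hw).
- intros H; split.
  + apply is_linear_scal_l.
  + intros x Hx eps.
    rewrite <- (@is_filter_lim_locally_unique C_AbsRing CN _ _ Hx).
    destruct (H eps (cond_pos eps)) as [d [Hd Hb]].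
    exists (mkposreal d Hd); intros w Hw; apply (Hb w Hw).
Qed.

Definition cexp (z : C) : C := (exp (Re z) * cos (Im z), exp (Re z) * sin (Im z)).

Lemma cexp_plus (z w : C) : cexp (z + w) = (cexp z * cexp w)%C.
Proof.
destruct z as [a b], w as [c d]; unfold cexp, Cmult; simpl.
rewrite exp_plus, cos_plus, sin_plus; apply injective_projections; simpl; ring.
Qed.

Lemma cexp_0 : cexp 0 = RtoC 1.
Proof.
unfold cexp; simpl; rewrite exp_0, cos_0, sin_0.
apply injective_projections; simpl; ring.
Qed.

Lemma Cmod_cexp (z : C) : Cmod (cexp z) = exp (Re z).
Proof.
unfold Cmod, cexp; simpl fst; simpl snd.
replace ((exp (Re z) * cos (Im z)) ^ 2 + (exp (Re z) * sin (Im z)) ^ 2)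
  with (exp (Re z) * exp (Re z)).
- apply sqrt_square; left; apply exp_pos.
- generalize (sin2_cos2 (Im z)); unfold Rsqr; intros E.
  transitivity (exp (Re z) * exp (Re z)
    * (sin (Im z) * sin (Im z) + cos (Im z) * cos (Im z))); [rewrite E |]; ring.
Qed.

Lemma cexp_neq_0 (z : C) : cexp z <> RtoC 0.
Proof. apply Cmod_gt_0; rewrite Cmod_cexp; apply exp_pos. Qed.

Lemma cexp_opp_r (z : C) : (cexp z * cexp (- z))%C = RtoC 1.
Proof. rewrite <- cexp_plus, <- cexp_0; f_equal; ring. Qed.

(** Polar coordinates. The bound on the imaginary part makes a circle the image of
    a compact interval. *)
Lemma cexp_surj (z : C) : z <> RtoC 0 ->
  exists w, cexp w = z /\ - PI <= Im w <= PI.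
Proof.
intros Hz; assert (Hr : 0 < Cmod z) by (apply Cmod_gt_0; exact Hz).
set (r := Cmod z) in *; set (c := Re z / r).
assert (E : r * r = Re z * Re z + Im z * Im z).
{ generalize (Cmod2_alt z); fold r; simpl; lra. }
assert (Hc : -1 <= c <= 1).
{ assert (c * c <= 1).
  { unfold c; replace (Re z / r * (Re z / r)) with ((Re z * Re z) / (r * r))
      by (field; lra).
    apply Rmult_le_reg_r with (r * r); [nra |].
    replace (Re z * Re z / (r * r) * (r * r)) with (Re z * Re z) by (field; lra).
    nra. }
  split; nra. }
assert (Hs : r * sqrt (1 - c * c) = Rabs (Im z)).
{ rewrite <- (sqrt_square r) by lra.
  rewrite <- sqrt_mult by nra.
  replace (r * r * (1 - c * c)) with (Rsqr (Im z)).
  - apply sqrt_Rsqr_abs.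
  - unfold c, Rsqr.
    replace (r * r * (1 - Re z / r * (Re z / r))) with (r * r - Re z * Re z)
      by (field; lra). lra. }
assert (Hrc : r * c = Re z) by (unfold c; field; lra).
assert (Ha := acos_bound c).
destruct (Rle_dec 0 (Im z)) as [Hi | Hi].
- exists (ln r, acos c); split; [| simpl; lra]; unfold cexp; simpl.
  rewrite (exp_ln r Hr), (cos_acos c Hc), (sin_acos c Hc).
  unfold Rsqr; rewrite Hrc, Hs, Rabs_pos_eq by lra.
  apply injective_projections; reflexivity.
- exists (ln r, - acos c); split; [| simpl; lra]; unfold cexp; simpl.
  rewrite (exp_ln r Hr), cos_neg, sin_neg, (cos_acos c Hc), (sin_acos c Hc).
  unfold Rsqr; rewrite Ropp_mult_distr_r_reverse, Hrc, Hs, Rabs_left by lra.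
  apply injective_projections; simpl; [reflexivity | apply Ropp_involutive].
Qed.

Lemma Cmod_le_sum (z : C) : Cmod z <= Rabs (Re z) + Rabs (Im z).
Proof.
apply Rsqr_incr_0; unfold Rsqr.
- generalize (Cmod2_alt z), (Rabs_pos (Re z)), (Rabs_pos (Im z)).
  generalize (Rsqr_abs (Re z)), (Rsqr_abs (Im z)); unfold Rsqr; simpl; nra.
- apply Cmod_ge_0.
- generalize (Rabs_pos (Re z)), (Rabs_pos (Im z)); lra.
Qed.

Lemma im_le_Cmod (z : C) : Rabs (Im z) <= Cmod z.
Proof. eapply Rle_trans; [apply Rmax_r | apply Rmax_Cmod]. Qed.

Lemma derivable_0_bound (f : R -> R) (l : R) :
  derivable_pt_lim f 0 l -> forall eps, 0 < eps -> exists delta, 0 < delta /\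
  forall x, Rabs x < delta -> Rabs (f x - f 0 - x * l) <= eps * Rabs x.
Proof.
intros H eps Heps; destruct (H eps Heps) as [d Hd].
exists d; split; [apply cond_pos |]; intros x Hx.
destruct (Req_dec x 0) as [-> | Hx0].
- replace (f 0 - f 0 - 0 * l) with 0 by ring; rewrite Rabs_R0; lra.
- generalize (Hd x Hx0 Hx); rewrite Rplus_0_l; intros B.
  replace (f x - f 0 - x * l) with (((f x - f 0) / x - l) * x) by (field; auto).
  rewrite Rabs_mult; apply Rmult_le_compat_r; [apply Rabs_pos | lra].
Qed.

Lemma cexp_near_0 eps : 0 < eps -> exists delta, 0 < delta /\
  forall h, Cmod h < delta -> Cmod (cexp h - 1 - h) <= eps * Cmod h.
Proof.
(* The estimates of the two components at the end add up to at most 6 e |h|. *)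
intros Heps; set (e := Rmin 1 eps / 7).
assert (He : 0 < e <= 1 /\ 7 * e <= eps).
{ unfold e; generalize (Rmin_l 1 eps), (Rmin_r 1 eps).
  assert (0 < Rmin 1 eps) by (apply Rmin_pos; lra). lra. }
destruct (derivable_0_bound exp 1) with (eps := e) as [d1 [Hd1 B1]]; [ | lra |].
{ generalize (derivable_pt_lim_exp 0); rewrite exp_0; auto. }
destruct (derivable_0_bound cos 0) with (eps := e) as [d2 [Hd2 B2]]; [ | lra |].
{ generalize (derivable_pt_lim_cos 0); rewrite sin_0, Ropp_0; auto. }
destruct (derivable_0_bound sin 1) with (eps := e) as [d3 [Hd3 B3]]; [ | lra |].
{ generalize (derivable_pt_lim_sin 0); rewrite cos_0; auto. }
set (d := Rmin (Rmin d1 d2) (Rmin d3 (e / 2))).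
assert (Hd : 0 < d) by (unfold d; repeat apply Rmin_pos; lra).
assert (D : d <= d1 /\ d <= d2 /\ d <= d3 /\ d <= e / 2).
{ unfold d; generalize (Rmin_l (Rmin d1 d2) (Rmin d3 (e / 2))),
   (Rmin_r (Rmin d1 d2) (Rmin d3 (e / 2))), (Rmin_l d1 d2), (Rmin_r d1 d2),
   (Rmin_l d3 (e / 2)), (Rmin_r d3 (e / 2)); lra. }
exists d; split; [exact Hd |]; intros h Hh.
generalize (re_le_Cmod h), (im_le_Cmod h); intros Hx Hy.
set (x := Re h) in *; set (y := Im h) in *.
assert (A1 := B1 x ltac:(lra)); assert (A2 := B2 y ltac:(lra));
assert (A3 := B3 y ltac:(lra)).
rewrite exp_0 in A1; rewrite cos_0 in A2; rewrite sin_0 in A3.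
assert (K1 : Rabs (exp x - 1) <= e).
{ replace (exp x - 1) with ((exp x - 1 - x * 1) + x) by ring.
  eapply Rle_trans; [apply Rabs_triang |]. nra. }
apply Rabs_le_between in K1.
eapply Rle_trans; [apply Cmod_le_sum |].
replace (Re (cexp h - 1 - h))
  with ((exp x - 1 - x * 1) * cos y + (1 + x) * (cos y - 1 - y * 0))
  by (unfold x, y, cexp, Cminus, Cplus, Copp, Re, Im; simpl; ring).
replace (Im (cexp h - 1 - h))
  with (exp x * (sin y - 0 - y * 1) + (exp x - 1) * y)
  by (unfold x, y, cexp, Cminus, Cplus, Copp, Re, Im; simpl; ring).
generalize (Rabs_pos x), (Rabs_pos y); intros Px Py.
assert (Hc : Rabs (cos y) <= 1) by (apply Rabs_le; generalize (COS_bound y); lra).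
assert (H1x : Rabs (1 + x) <= 2).
{ eapply Rle_trans; [apply Rabs_triang |]; rewrite Rabs_R1; lra. }
assert (T1 : Rabs ((exp x - 1 - x * 1) * cos y + (1 + x) * (cos y - 1 - y * 0))
   <= e * Rabs x * 1 + 2 * (e * Rabs y)).
{ eapply Rle_trans; [apply Rabs_triang |]; rewrite !Rabs_mult.
  apply Rplus_le_compat; apply Rmult_le_compat; try apply Rabs_pos; assumption. }
assert (T2 : Rabs (exp x * (sin y - 0 - y * 1) + (exp x - 1) * y)
   <= 2 * (e * Rabs y) + e * Rabs y).
{ eapply Rle_trans; [apply Rabs_triang |]; rewrite !Rabs_mult.
  apply Rplus_le_compat; apply Rmult_le_compat; try apply Rabs_pos; try assumption.
  - apply Rabs_le; lra.
  - apply Rabs_le; lra.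
  - lra. }
nra.
Qed.

Lemma is_derive_cexp (z : C) : @is_derive C_AbsRing CN cexp z (cexp z).
Proof.
apply is_derive_C_eps; intros eps Heps.
set (m := Cmod (cexp z)).
assert (Hm : 0 < m) by (unfold m; rewrite Cmod_cexp; apply exp_pos).
destruct (cexp_near_0 (eps / m)) as [d [Hd B]].
{ apply Rdiv_lt_0_compat; lra. }
exists d; split; [exact Hd |]; intros w Hw; specialize (B _ Hw).
change (Cmod (cexp w - cexp z - (w - z) * cexp z) <= eps * Cmod (w - z)).
replace (cexp w - cexp z - (w - z) * cexp z)%C
  with (cexp z * (cexp (w - z) - 1 - (w - z)))%C.
- rewrite Cmod_mult; fold m.
  apply Rle_trans with (m * (eps / m * Cmod (w - z))).
  + apply Rmult_le_compat_l; lra.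
  + right; field; lra.
- replace (cexp w) with (cexp z * cexp (w - z))%C; [ring |].
  rewrite <- cexp_plus; f_equal; ring.
Qed.

(** * Integrals of complex curves *)

Definition path (f : R -> C) : Prop := forall t, @continuous R_UniformSpace CN f t.

Definition CInt (f : R -> C) (a b : R) : C :=
  (RInt (fun t => Re (f t)) a b, RInt (fun t => Im (f t)) a b).

Lemma continuous_component (p : C -> R) (f : R -> C) :
  (forall z w : C, Rabs (p z - p w) <= Cmod (z - w)) -> path f ->
  forall t, continuous (fun t => p (f t)) t.
Proof.
intros Hp Hf t; apply filterlim_locally; intros eps.
generalize (proj1 (filterlim_locally _ _) (Hf t) eps).
apply filter_imp; intros x Hx.
eapply Rle_lt_trans; [apply Hp | exact Hx].
Qed.

Lemma path_ex_RInt_Re f a b : path f -> ex_RInt (fun t => Re (f t)) a b.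
Proof.
intros Hf; apply (@ex_RInt_continuous R_CompleteNormedModule); intros t _.
apply (continuous_component Re); [| exact Hf].
intros z w; apply (re_le_Cmod (z - w)).
Qed.

Lemma path_ex_RInt_Im f a b : path f -> ex_RInt (fun t => Im (f t)) a b.
Proof.
intros Hf; apply (@ex_RInt_continuous R_CompleteNormedModule); intros t _.
apply (continuous_component Im); [| exact Hf].
intros z w; apply (im_le_Cmod (z - w)).
Qed.

#[local] Hint Resolve path_ex_RInt_Re path_ex_RInt_Im : core.

Lemma CInt_ext f g a b : (forall t, f t = g t) -> CInt f a b = CInt g a b.
Proof.
intros E; unfold CInt; f_equal; apply RInt_ext; intros t _; rewrite E; reflexivity.
Qed.

Lemma CInt_plus f g a b : path f -> path g ->
  CInt (fun t => f t + g t)%C a b = (CInt f a b + CInt g a b)%C.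
Proof.
intros Hf Hg; apply injective_projections;
  [apply (RInt_plus (fun t => Re (f t)) (fun t => Re (g t))) |
   apply (RInt_plus (fun t => Im (f t)) (fun t => Im (g t)))]; auto.
Qed.

Lemma CInt_scal c f a b : path f ->
  CInt (fun t => c * f t)%C a b = (c * CInt f a b)%C.
Proof.
intros Hf.
assert (S : forall u v : R -> R, ex_RInt u a b -> ex_RInt v a b -> forall p q,
  RInt (fun t => p * u t + q * v t) a b = p * RInt u a b + q * RInt v a b).
{ intros u v Hu Hv p q.
  rewrite (RInt_plus (fun t => p * u t) (fun t => q * v t));
    [ | apply (ex_RInt_scal u), Hu | apply (ex_RInt_scal v), Hv].
  apply f_equal2; [apply (RInt_scal u), Hu | apply (RInt_scal v), Hv]. }
apply injective_projections; simpl.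
- rewrite <- (Ropp_involutive (snd c)) at 1.
  transitivity (RInt (fun t => fst c * Re (f t) + - snd c * Im (f t)) a b).
  + apply RInt_ext; intros t _; unfold Re, Im; simpl; ring.
  + rewrite S by auto; unfold CInt; simpl; ring.
- rewrite <- S by auto; apply RInt_ext; intros t _; unfold Re, Im; simpl; ring.
Qed.

Lemma CInt_Chasles f a b c : path f -> (CInt f a b + CInt f b c)%C = CInt f a c.
Proof.
intros Hf; apply injective_projections;
 [apply (RInt_Chasles (fun t => Re (f t))) | apply (RInt_Chasles (fun t => Im (f t)))];
 auto.
Qed.

Lemma CInt_point f a : CInt f a a = RtoC 0.
Proof. apply injective_projections; exact (RInt_point a _). Qed.

Lemma CInt_shift f s a b : path f ->
  CInt (fun t => f (t + s)) a b = CInt f (a + s) (b + s).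
Proof.
intros Hf.
assert (S : forall u : R -> R, ex_RInt u (a + s) (b + s) ->
   RInt (fun t => u (t + s)) a b = RInt u (a + s) (b + s)).
{ intros u Hu; generalize (RInt_comp_lin u 1 s a b); rewrite !Rmult_1_l.
  intros E; rewrite <- (E Hu); apply RInt_ext; intros t _.
  rewrite (Rmult_1_l t); symmetry; apply Rmult_1_l. }
apply injective_projections; simpl;
 [apply (S (fun t => Re (f t))) | apply (S (fun t => Im (f t)))]; auto.
Qed.

(** The factor 2 comes from estimating the real and the imaginary part separately;
    constants do not matter for tameness. *)
Lemma CInt_bound f a b M : path f -> a <= b ->
  (forall t, a <= t <= b -> Cmod (f t) <= M) -> Cmod (CInt f a b) <= 2 * (b - a) * M.
Proof.
intros Hf Hab HM.
eapply Rle_trans; [apply Cmod_le_sum |].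
replace (2 * (b - a) * M) with ((b - a) * M + (b - a) * M) by ring.
apply Rplus_le_compat; apply abs_RInt_le_const; auto; intros t Ht.
- eapply Rle_trans; [apply re_le_Cmod | auto].
- eapply Rle_trans; [apply im_le_Cmod | auto].
Qed.

Lemma CInt_const c a b : CInt (fun _ => c) a b = (RtoC (b - a) * c)%C.
Proof.
apply injective_projections; unfold CInt; simpl; rewrite RInt_const;
 unfold scal; simpl; unfold mult; simpl; unfold Re, Im; ring.
Qed.

Lemma CInt_id a b : CInt RtoC a b = RtoC ((b * b - a * a) / 2).
Proof.
apply injective_projections; unfold CInt; simpl.
- apply is_RInt_unique.
  replace ((b * b - a * a) / 2) with (minus (b * b / 2) (a * a / 2))
    by (unfold minus, plus, opp; simpl; field).
  apply (is_RInt_derive (fun t => t * t / 2) (fun t => t)).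
  + intros x _; auto_derive; [exact I | field].
  + intros x _; apply continuous_id.
- rewrite RInt_const; apply Rmult_0_r.
Qed.

Lemma path_const c : path (fun _ => c).
Proof. intros t; apply continuous_const. Qed.

Lemma path_plus f g : path f -> path g -> path (fun t => f t + g t)%C.
Proof. intros Hf Hg t; apply (@continuous_plus R_UniformSpace C_AbsRing CN); auto. Qed.

Lemma path_mult f g : path f -> path g -> path (fun t => f t * g t)%C.
Proof. intros Hf Hg t; apply (@continuous_mult R_UniformSpace C_AbsRing); auto. Qed.

Lemma path_RtoC : path RtoC.
Proof.
intros t; apply filterlim_locally; intros eps; exists eps; intros x Hx.
change (Cmod (RtoC x - RtoC t) < eps); rewrite <- RtoC_minus, Cmod_R; exact Hx.
Qed.

(** * Goursat's theorem on rectangles *)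

Lemma nested_intervals (a b : nat -> R) :
  (forall n, a n <= a (S n)) -> (forall n, b (S n) <= b n) -> (forall n, a n <= b n) ->
  exists x, forall n, a n <= x <= b n.
Proof.
intros Ha Hb Hab.
assert (Mb : forall n m, (n <= m)%nat -> b m <= b n).
{ intros n m H; induction H as [| m H IH]; [lra | specialize (Hb m); lra]. }
assert (Ma : forall n m, (n <= m)%nat -> a n <= a m).
{ intros n m H; induction H as [| m H IH]; [lra | specialize (Ha m); lra]. }
assert (C : forall n m, a n <= b m).
{ intros n m; destruct (Nat.le_ge_cases n m) as [H | H].
  - apply Rle_trans with (a m); auto.
  - apply Rle_trans with (b n); auto. }
destruct (ex_finite_lim_seq_incr a (b 0%nat) Ha (fun n => C n 0%nat)) as [x Hx].
exists x; intros n; split.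
- apply (is_lim_seq_incr_compare a x Hx Ha).
- apply (is_lim_seq_le a (fun _ => b n) x (b n)); auto; apply is_lim_seq_const.
Qed.

(** If |Phi| exceeds eps times the square of the semiperimeter on a rectangle,
    then by additivity it does so on one of the four quarters: the right-hand side
    of each is a quarter of the original one. Iteration leads to rectangles that
    shrink to a point, against the local bound there. *)
Lemma rectangle_bisection (Phi : R -> R -> R -> R -> C) :
  (forall a m b c d, Phi a b c d = Phi a m c d + Phi m b c d)%C ->
  (forall a b c m d, Phi a b c d = Phi a b c m + Phi a b m d)%C ->
  (forall x y eps, 0 < eps -> exists delta, 0 < delta /\
     forall a b c d, a <= x <= b -> c <= y <= d -> b - a + (d - c) < delta ->
       Cmod (Phi a b c d) <= eps * (b - a + (d - c)) ^ 2) ->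
  forall a b c d, a <= b -> c <= d -> Phi a b c d = RtoC 0.
Proof.
intros Hx Hy Hloc a b c d Hab Hcd.
assert (K : forall eps, 0 < eps -> Cmod (Phi a b c d) <= eps * (b - a + (d - c)) ^ 2).
2: { apply Cmod_eq_0, Rle_antisym; [| apply Cmod_ge_0].
  apply le_epsilon; intros e He; rewrite Rplus_0_l.
  set (S := (b - a + (d - c)) ^ 2) in *.
  assert (HS : 0 <= S) by apply pow2_ge_0.
  eapply Rle_trans; [apply (K (e / (S + 1))); apply Rdiv_lt_0_compat; lra |].
  apply Rmult_le_reg_r with (S + 1); [lra |].
  replace (e / (S + 1) * S * (S + 1)) with (e * S) by (field; lra). nra. }
intros eps Heps; apply Rnot_lt_le; intros Hbad.
set (bad := fun s : (R * R) * (R * R) =>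
  let '((a, b), (c, d)) := s in
  a <= b /\ c <= d /\ eps * (b - a + (d - c)) ^ 2 < Cmod (Phi a b c d)).
set (half := fun s s' : (R * R) * (R * R) =>
  let '((a, b), (c, d)) := s in let '((a', b'), (c', d')) := s' in
  a <= a' /\ b' <= b /\ c <= c' /\ d' <= d /\
  b' - a' = (b - a) / 2 /\ d' - c' = (d - c) / 2).
(* One of the four quarters of a bad rectangle is bad. *)
assert (step : forall s : sig bad, exists s' : sig bad, half (proj1_sig s) (proj1_sig s')).
{ intros [[[a1 b1] [c1 d1]] [H1 [H2 H3]]]; simpl.
  set (m := (a1 + b1) / 2); set (p := (c1 + d1) / 2).
  assert (Q : forall a' b' c' d', a1 <= a' -> b' <= b1 -> c1 <= c' -> d' <= d1 ->
    b' - a' = (b1 - a1) / 2 -> d' - c' = (d1 - c1) / 2 ->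
    eps * ((b1 - a1 + (d1 - c1)) / 2) ^ 2 < Cmod (Phi a' b' c' d') ->
    exists s' : sig bad,
     let '((a', b'), (c', d')) := proj1_sig s' in
      a1 <= a' /\ b' <= b1 /\ c1 <= c' /\ d' <= d1 /\
      b' - a' = (b1 - a1) / 2 /\ d' - c' = (d1 - c1) / 2).
  { intros a' b' c' d' A B C' D E F G.
    assert (Hs : bad ((a', b'), (c', d'))).
    { unfold bad; split; [lra | split; [lra |]].
      replace (b' - a' + (d' - c')) with ((b1 - a1 + (d1 - c1)) / 2) by lra.
      exact G. }
    exists (exist bad _ Hs); simpl; auto 10. }
  assert (Bm : a1 <= m <= b1 /\ m - a1 = (b1 - a1) / 2 /\ b1 - m = (b1 - a1) / 2)
    by (unfold m; lra).
  assert (Bp : c1 <= p <= d1 /\ p - c1 = (d1 - c1) / 2 /\ d1 - p = (d1 - c1) / 2)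
    by (unfold p; lra).
  destruct (Rlt_dec (eps * ((b1 - a1 + (d1 - c1)) / 2) ^ 2) (Cmod (Phi a1 m c1 p)))
    as [T1 | T1]; [apply (Q a1 m c1 p); lra |].
  destruct (Rlt_dec (eps * ((b1 - a1 + (d1 - c1)) / 2) ^ 2) (Cmod (Phi a1 m p d1)))
    as [T2 | T2]; [apply (Q a1 m p d1); lra |].
  destruct (Rlt_dec (eps * ((b1 - a1 + (d1 - c1)) / 2) ^ 2) (Cmod (Phi m b1 c1 p)))
    as [T3 | T3]; [apply (Q m b1 c1 p); lra |].
  destruct (Rlt_dec (eps * ((b1 - a1 + (d1 - c1)) / 2) ^ 2) (Cmod (Phi m b1 p d1)))
    as [T4 | T4]; [apply (Q m b1 p d1); lra |].
  exfalso.
  rewrite (Hx a1 m b1), (Hy a1 m c1 p d1), (Hy m b1 c1 p d1) in H3.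
  generalize (Cmod_triangle (Phi a1 m c1 p + Phi a1 m p d1) (Phi m b1 c1 p + Phi m b1 p d1)),
   (Cmod_triangle (Phi a1 m c1 p) (Phi a1 m p d1)),
   (Cmod_triangle (Phi m b1 c1 p) (Phi m b1 p d1)).
  nra. }
set (next := fun s => proj1_sig (constructive_indefinite_description _ (step s))).
assert (Hnext : forall s, half (proj1_sig s) (proj1_sig (next s))).
{ intros s; exact (proj2_sig (constructive_indefinite_description _ (step s))). }
assert (H0 : bad ((a, b), (c, d))) by (simpl; auto).
set (u := fun n => Nat.iter n next (exist bad _ H0)).
set (ua := fun n => fst (fst (proj1_sig (u n)))).
set (ub := fun n => snd (fst (proj1_sig (u n)))).
set (uc := fun n => fst (snd (proj1_sig (u n)))).
set (ud := fun n => snd (snd (proj1_sig (u n)))).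
assert (Hb : forall n, ua n <= ub n /\ uc n <= ud n /\
  eps * (ub n - ua n + (ud n - uc n)) ^ 2 < Cmod (Phi (ua n) (ub n) (uc n) (ud n))).
{ intros n; unfold ua, ub, uc, ud; destruct (u n) as [[[? ?] [? ?]] H]; exact H. }
assert (Hs : forall n, ua n <= ua (S n) /\ ub (S n) <= ub n /\
   uc n <= uc (S n) /\ ud (S n) <= ud n /\
   ub (S n) - ua (S n) = (ub n - ua n) / 2 /\ ud (S n) - uc (S n) = (ud n - uc n) / 2).
{ intros n; generalize (Hnext (u n)).
  change (next (u n)) with (u (S n)); unfold ua, ub, uc, ud, half.
  destruct (proj1_sig (u n)) as [[? ?] [? ?]],
    (proj1_sig (u (S n))) as [[? ?] [? ?]]; auto. }
destruct (nested_intervals ua ub) as [x Px]; try (intros n; apply Hs || apply Hb).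
destruct (nested_intervals uc ud) as [y Py]; try (intros n; apply Hs || apply Hb).
assert (Hsize : forall n,
  ub n - ua n + (ud n - uc n) = (b - a + (d - c)) * (/ 2) ^ n).
{ induction n as [| n IH]; [simpl; unfold ua, ub, uc, ud; simpl; ring |].
  destruct (Hs n) as [_ [_ [_ [_ [-> ->]]]]]; simpl.
  transitivity ((ub n - ua n + (ud n - uc n)) / 2); [field |].
  rewrite IH; field. }
destruct (Hloc x y eps Heps) as [delta [Hdelta L]].
destruct (pow_lt_1_zero (/ 2)) with (y := delta / (b - a + (d - c) + 1)) as [N HN].
{ rewrite Rabs_pos_eq; lra. }
{ apply Rdiv_lt_0_compat; lra. }
specialize (HN N (Nat.le_refl N)).
rewrite Rabs_pos_eq in HN by (apply pow_le; lra).
apply (Rlt_not_le _ _ (proj2 (proj2 (Hb N)))).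
apply L; [apply Px | apply Py |].
rewrite Hsize.
assert (Hp : 0 < (/ 2) ^ N) by (apply pow_lt; lra).
apply Rle_lt_trans with ((b - a + (d - c) + 1) * (/ 2) ^ N); [nra |].
replace delta with ((b - a + (d - c) + 1) * (delta / (b - a + (d - c) + 1)))
  by (field; lra).
apply Rmult_lt_compat_l; lra.
Qed.

(** The integral of [H] along the boundary of the rectangle between the abscissas
    [a], [b] and the ordinates [c], [d], counterclockwise. *)
Definition rect_int (H : C -> C) (a b c d : R) : C :=
  (CInt (fun x => H (x, c)) a b - CInt (fun x => H (x, d)) a b
   + Ci * (CInt (fun y => H (b, y)) c d - CInt (fun y => H (a, y)) c d))%C.

Definition sep_path (H : C -> C) : Prop :=
  (forall y, path (fun x => H (x, y))) /\ (forall x, path (fun y => H (x, y))).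

Lemma continuous_sep_path (H : C -> C) :
  (forall z, @continuous CN CN H z) -> sep_path H.
Proof.
intros Hc; split; intros s t;
 (apply (@continuous_comp R_UniformSpace CN CN); [| apply Hc]);
 apply filterlim_locally; intros eps; exists eps; intros x Hx.
- change (Cmod ((x, s) - (t, s)) < eps).
  replace ((x, s) - (t, s))%C with (RtoC (x - t))
   by (apply injective_projections; simpl; ring).
  rewrite Cmod_R; exact Hx.
- change (Cmod ((s, x) - (s, t)) < eps).
  replace ((s, x) - (s, t))%C with (Ci * RtoC (x - t))%C
   by (apply injective_projections; simpl; ring).
  rewrite Cmod_mult, Cmod_Ci, Cmod_R, Rmult_1_l; exact Hx.
Qed.

Lemma rect_int_ext H K a b c d : (forall z, H z = K z) ->
  rect_int H a b c d = rect_int K a b c d.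
Proof.
intros E; unfold rect_int.
rewrite (CInt_ext (fun x => H (x, c)) (fun x => K (x, c))),
 (CInt_ext (fun x => H (x, d)) (fun x => K (x, d))),
 (CInt_ext (fun y => H (b, y)) (fun y => K (b, y))),
 (CInt_ext (fun y => H (a, y)) (fun y => K (a, y))) by auto; reflexivity.
Qed.

Lemma rect_int_plus H K a b c d : sep_path H -> sep_path K ->
  rect_int (fun z => H z + K z)%C a b c d = (rect_int H a b c d + rect_int K a b c d)%C.
Proof.
intros [H1 H2] [K1 K2]; unfold rect_int.
rewrite (CInt_plus (fun x => H (x, c)) (fun x => K (x, c))),
 (CInt_plus (fun x => H (x, d)) (fun x => K (x, d))),
 (CInt_plus (fun y => H (b, y)) (fun y => K (b, y))),
 (CInt_plus (fun y => H (a, y)) (fun y => K (a, y))) by auto; ring.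
Qed.

Lemma rect_int_bound H a b c d M : sep_path H -> a <= b -> c <= d ->
  (forall x y, a <= x <= b -> c <= y <= d -> Cmod (H (x, y)) <= M) ->
  Cmod (rect_int H a b c d) <= 4 * (b - a + (d - c)) * M.
Proof.
intros [H1 H2] Hab Hcd HM; unfold rect_int.
eapply Rle_trans; [apply Cmod_triangle |].
rewrite Cmod_mult, Cmod_Ci, Rmult_1_l; unfold Cminus.
eapply Rle_trans; [apply Rplus_le_compat; apply Cmod_triangle |].
rewrite !Cmod_opp.
generalize (CInt_bound (fun x => H (x, c)) a b M (H1 c) Hab),
 (CInt_bound (fun x => H (x, d)) a b M (H1 d) Hab),
 (CInt_bound (fun x => H (b, x)) c d M (H2 b) Hcd),
 (CInt_bound (fun x => H (a, x)) c d M (H2 a) Hcd); intros A B C' D.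
assert (A' := A ltac:(intros; apply HM; lra)); assert (B' := B ltac:(intros; apply HM; lra));
assert (C'' := C' ltac:(intros; apply HM; lra));
assert (D' := D ltac:(intros; apply HM; lra)); lra.
Qed.

Lemma CInt_affine p q a b :
  CInt (fun t => p + q * RtoC t)%C a b
   = (RtoC (b - a) * p + q * RtoC ((b * b - a * a) / 2))%C.
Proof.
rewrite CInt_plus, CInt_const, CInt_scal, CInt_id; [reflexivity | ..].
- apply path_RtoC.
- apply path_const.
- apply path_mult; [apply path_const | apply path_RtoC].
Qed.

(** Affine functions have primitives; here the integrals are computed outright. *)
Lemma rect_int_affine p q a b c d : rect_int (fun z => p + q * z)%C a b c d = RtoC 0.
Proof.
unfold rect_int.
assert (Hh : forall y, CInt (fun x => p + q * (x, y))%C a b =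
  CInt (fun x => (p + q * (0, y)) + q * RtoC x)%C a b).
{ intros y; apply CInt_ext; intros x.
  replace (x, y) with ((0, y) + RtoC x)%C by (apply injective_projections; simpl; ring).
  ring. }
assert (Hv : forall x, CInt (fun y => p + q * (x, y))%C c d =
  CInt (fun y => (p + q * RtoC x) + (q * Ci) * RtoC y)%C c d).
{ intros x; apply CInt_ext; intros y.
  replace (x, y) with (RtoC x + Ci * RtoC y)%C by (apply injective_projections; simpl; ring).
  ring. }
rewrite !Hh, !Hv, !CInt_affine.
replace (0, c) with (Ci * RtoC c)%C by (apply injective_projections; simpl; ring).
replace (0, d) with (Ci * RtoC d)%C by (apply injective_projections; simpl; ring).
unfold Rdiv; rewrite !RtoC_mult, !RtoC_minus, !RtoC_mult.
replace (RtoC (/ 2)) with (Ci * RtoC (/ 2) * (- Ci))%C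
  by (apply injective_projections; simpl; ring).
apply injective_projections; simpl; destruct p, q; simpl; field.
Qed.

(** Near a point, a differentiable function is affine up to an error that is small
    against the distance. The affine part does not contribute to the integral along
    the boundary, and the error contributes little against the square of the
    semiperimeter: this is the local bound required by [rectangle_bisection]. *)
Theorem goursat (H : C -> C) :
  (forall z, @ex_derive C_AbsRing CN H z) ->
  forall a b c d, a <= b -> c <= d -> rect_int H a b c d = RtoC 0.
Proof.
intros Hd.
assert (Hs : sep_path H).
{ apply continuous_sep_path; intros z; apply (@ex_derive_continuous C_AbsRing CN), Hd. }
apply rectangle_bisection.
- intros a m b c d; unfold rect_int.
  rewrite <- (CInt_Chasles (fun x => H (x, c)) a m b),
    <- (CInt_Chasles (fun x => H (x, d)) a m b) by apply Hs; ring.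
- intros a b c m d; unfold rect_int.
  rewrite <- (CInt_Chasles (fun x => H (a, x)) c m d),
    <- (CInt_Chasles (fun x => H (b, x)) c m d) by apply Hs; ring.
- intros x0 y0 eps Heps; set (w := (x0, y0) : C).
  destruct (Hd w) as [l Hl].
  destruct (proj1 (@is_derive_C_eps CN H w l) Hl (eps / 4)) as [delta [Hdelta B]]; [lra |].
  exists delta; split; [exact Hdelta |]; intros a b c d Hx Hy Hsmall.
  set (A := fun z => ((H w - l * w) + l * z)%C).
  assert (HA : forall z, @continuous CN CN A z).
  { intros z; apply (@continuous_plus CN C_AbsRing CN); [apply continuous_const |].
    apply (@continuous_mult CN C_AbsRing); [apply continuous_const | apply continuous_id]. }
  set (E := fun z => (H z - A z)%C).
  assert (HE : sep_path E).
  { apply continuous_sep_path; intros z.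
    apply (@continuous_minus CN C_AbsRing CN); [| apply HA].
    apply (@ex_derive_continuous C_AbsRing CN), Hd. }
  replace (rect_int H a b c d) with (rect_int (fun z => A z + E z)%C a b c d).
  2: { apply rect_int_ext; intros z; unfold E; ring. }
  rewrite rect_int_plus; [| apply continuous_sep_path, HA | exact HE].
  unfold A at 1; rewrite rect_int_affine, Cplus_0_l.
  set (s := b - a + (d - c)) in *.
  apply Rle_trans with (4 * s * (eps / 4 * s)); [| right; field].
  apply rect_int_bound; [exact HE | lra | lra |].
  intros x y Hx' Hy'.
  assert (D : Cmod ((x, y) - w) <= s).
  { eapply Rle_trans; [apply Cmod_le_sum |]; unfold w, Re, Im; simpl.
    apply Rplus_le_compat; apply Rabs_le; lra. }
  assert (B' := B (x, y) ltac:(lra)).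
  replace (E (x, y)) with (H (x, y) - H w - ((x, y) - w) * l)%C by (unfold E, A; ring).
  eapply Rle_trans; [exact B' |]; apply Rmult_le_compat_l; lra.
Qed.

(** * Laurent coefficients *)

Definition imag (t : R) : C := (0, t).

Definition derivable_off_0 {V : NormedModule C_AbsRing} (f : C -> V) : Prop :=
  forall z, z <> RtoC 0 -> @ex_derive C_AbsRing V f z.

Notation hol_off_0 := (@derivable_off_0 CN).

Definition cont_off_0 (g : C -> C) : Prop :=
  forall z, z <> RtoC 0 -> @continuous CN CN g z.

Lemma hol_cont_off_0 g : hol_off_0 g -> cont_off_0 g.
Proof. intros H z Hz; apply (@ex_derive_continuous C_AbsRing CN), H, Hz. Qed.

Lemma is_derive_Cinv (z : C) : z <> RtoC 0 ->
  @is_derive C_AbsRing CN Cinv z (- / (z * z))%C.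
Proof.
intros Hz; assert (Hr : 0 < Cmod z) by (apply Cmod_gt_0; exact Hz).
apply is_derive_C_eps; intros eps Heps; set (r := Cmod z) in *.
exists (Rmin (r / 2) (eps * (r * r * r) / 2)); split.
{ apply Rmin_pos; [lra | apply Rdiv_lt_0_compat; [| lra]].
  repeat apply Rmult_lt_0_compat; lra. }
intros w Hw.
assert (H1 : Cmod (w - z) < r / 2) by (eapply Rlt_le_trans; [exact Hw | apply Rmin_l]).
assert (H2 : Cmod (w - z) < eps * (r * r * r) / 2)
  by (eapply Rlt_le_trans; [exact Hw | apply Rmin_r]).
assert (Hw2 : r / 2 < Cmod w).
{ generalize (Cmod_triangle w (- (w - z))); rewrite Cmod_opp.
  replace (w + - (w - z))%C with z by ring; fold r; lra. }
assert (Hw0 : w <> RtoC 0) by (apply Cmod_gt_0; lra).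
change (Cmod (/ w - / z - (w - z) * (- / (z * z))) <= eps * Cmod (w - z)).
replace (/ w - / z - (w - z) * (- / (z * z)))%C
  with ((w - z) * ((w - z) * / (w * (z * z))))%C by (field; auto).
rewrite Cmod_mult, Rmult_comm; apply Rmult_le_compat_r; [apply Cmod_ge_0 |].
rewrite Cmod_mult, Cmod_inv, !Cmod_mult by (repeat apply Cmult_neq_0; auto); fold r.
set (m := Cmod w) in *.
assert (P : r * r * r / 2 <= m * (r * r)) by nra.
assert (P3 : 0 < r * r * r) by (repeat apply Rmult_lt_0_compat; lra).
apply Rmult_le_reg_r with (m * (r * r)); [lra |].
rewrite Rmult_assoc, Rinv_l, Rmult_1_r by lra.
apply Rle_trans with (eps * (r * r * r / 2)); [lra |].
apply Rmult_le_compat_l; lra.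
Qed.

Lemma is_derive_Cmult_l (c z : C) : @is_derive C_AbsRing CN (fun w => c * w)%C z c.
Proof.
apply is_derive_C_eps; intros eps Heps; exists 1; split; [lra |]; intros w _.
change (Cmod (c * w - c * z - (w - z) * c) <= eps * Cmod (w - z)).
replace (c * w - c * z - (w - z) * c)%C with (RtoC 0) by ring.
rewrite Cmod_0; apply Rmult_le_pos; [lra | apply Cmod_ge_0].
Qed.

Lemma path_cexp_line (c w : C) : path (fun t => cexp (c * (w + imag t))).
Proof.
intros t; apply (@continuous_comp R_UniformSpace CN CN).
- assert (P : path (fun t => c * w + (c * Ci) * RtoC t)%C).
  { apply path_plus; [apply path_const | apply path_mult;
     [apply path_const | apply path_RtoC]]. }
  apply continuous_ext with (2 := P t); intros s.
  apply injective_projections; simpl; ring.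
- apply (@ex_derive_continuous C_AbsRing CN); eexists; apply is_derive_cexp.
Qed.

Lemma path_circle (g : C -> C) (w : C) : cont_off_0 g ->
  path (fun t => g (cexp (w + imag t))).
Proof.
intros Hg t; apply (@continuous_comp R_UniformSpace CN CN).
- apply continuous_ext with (2 := path_cexp_line 1 w t); intros s; f_equal; ring.
- apply Hg, cexp_neq_0.
Qed.

Notation ZtoC n := (RtoC (IZR n)) (only parsing).

Lemma cexp_nat (k : nat) (z : C) : cexp (ZtoC (Z.of_nat k) * z) = Cpow (cexp z) k.
Proof.
induction k as [| k IH]; simpl Cpow.
- rewrite <- cexp_0; f_equal; simpl; ring.
- rewrite <- IH, <- cexp_plus; f_equal.
  rewrite Nat2Z.inj_succ, succ_IZR, RtoC_plus; ring.
Qed.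

Lemma cexp_opp (z : C) : cexp (- z) = (/ cexp z)%C.
Proof.
assert (E := cexp_opp_r z); assert (N := cexp_neq_0 z).
replace (cexp (- z)) with (/ cexp z * (cexp z * cexp (- z)))%C by (field; auto).
rewrite E; ring.
Qed.

Lemma cexp_opp_nat (k : nat) (z : C) :
  cexp (ZtoC (- Z.of_nat k) * z) = Cpow (/ cexp z) k.
Proof.
rewrite <- cexp_opp, <- cexp_nat, opp_IZR, RtoC_opp; f_equal; ring.
Qed.

Lemma cexp_2PI : cexp (imag (2 * PI)) = RtoC 1.
Proof.
unfold cexp; simpl; rewrite exp_0, cos_2PI, sin_2PI.
apply injective_projections; simpl; ring.
Qed.

Lemma cexp_int_2PI (n : Z) : cexp (ZtoC n * (imag (2 * PI))) = RtoC 1.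
Proof.
assert (P : forall k, Cpow (RtoC 1) k = RtoC 1).
{ induction k as [| k IH]; simpl; [| rewrite IH]; ring. }
destruct (Z.le_ge_cases 0 n) as [H | H].
- rewrite <- (Z2Nat.id n H), cexp_nat, cexp_2PI; apply P.
- replace n with (- Z.of_nat (Z.to_nat (- n)))%Z by (rewrite Z2Nat.id; lia).
  rewrite cexp_opp_nat, cexp_2PI.
  replace (/ RtoC 1)%C with (RtoC 1) by (field; exact C1_nz); apply P.
Qed.

Lemma CInt_periodic f T s : path f -> (forall t, f (t + T) = f t) ->
  CInt f s (s + T) = CInt f 0 T.
Proof.
intros Hf HT.
rewrite <- (CInt_Chasles f s 0 (s + T) Hf), <- (CInt_Chasles f 0 T (s + T) Hf).
replace (CInt f T (s + T)) with (CInt f 0 s).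
- replace (CInt f 0 T) with (CInt f 0 T + CInt f s s)%C at 2
    by (rewrite CInt_point; ring).
  rewrite <- (CInt_Chasles f s 0 s Hf); ring.
- rewrite <- (Rplus_0_l T) at 1; rewrite <- CInt_shift by exact Hf.
  apply CInt_ext; intros t; symmetry; apply HT.
Qed.

Definition laurent (g : C -> C) (n : Z) : C :=
  (RtoC (/ (2 * PI)) *
   CInt (fun t => g (cexp (imag t)) * cexp (ZtoC (- n) * imag t)) 0 (2 * PI))%C.

(** The integrand of the [n]-th coefficient in the logarithmic coordinate [w]. It is
    entire and has period 2 pi i. *)
Definition fourier_integrand (g : C -> C) (n : Z) (w : C) : C :=
  (g (cexp w) * cexp (ZtoC (- n) * w))%C.

Lemma path_fourier_integrand g n w : cont_off_0 g ->
  path (fun t => fourier_integrand g n (w + imag t)%C).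
Proof. intros Hg; apply path_mult; [apply path_circle, Hg | apply path_cexp_line]. Qed.

Lemma fourier_integrand_periodic g n w :
  fourier_integrand g n (w + (imag (2 * PI)))%C = fourier_integrand g n w.
Proof.
unfold fourier_integrand; rewrite Cmult_plus_distr_l, !cexp_plus, cexp_2PI,
  cexp_int_2PI, !Cmult_1_r; reflexivity.
Qed.

Definition fourier_int (g : C -> C) (n : Z) (w : C) : C :=
  CInt (fun t => fourier_integrand g n (w + imag t)%C) 0 (2 * PI).

Lemma fourier_int_vertical g n w s : cont_off_0 g ->
  fourier_int g n (w + (imag s))%C = fourier_int g n w.
Proof.
intros Hg; unfold fourier_int.
rewrite <- (CInt_periodic (fun t => fourier_integrand g n (w + imag t)%C) _ s);
 [| apply path_fourier_integrand, Hg |].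
- replace (s + 2 * PI) with (2 * PI + s) by ring.
  replace (CInt (fun t => fourier_integrand g n (w + imag t)%C) s (2 * PI + s))
    with (CInt (fun t => fourier_integrand g n (w + imag t)%C) (0 + s) (2 * PI + s))
    by (rewrite Rplus_0_l; reflexivity).
  rewrite <- CInt_shift by apply path_fourier_integrand, Hg.
  apply CInt_ext; intros t; f_equal; apply injective_projections; simpl; ring.
- intros t; rewrite <- (fourier_integrand_periodic g n (w + imag t)%C); f_equal.
  apply injective_projections; simpl; ring.
Qed.

(** The horizontal sides of a rectangle of height 2 pi cancel by periodicity, so
    that by Goursat's theorem the integrals along the vertical sides agree. *)
Lemma fourier_int_horizontal g n a b : hol_off_0 g -> a <= b ->
  fourier_int g n (RtoC a) = fourier_int g n (RtoC b).
Proof.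
intros Hg Hab.
assert (Hd : forall z, @ex_derive C_AbsRing CN (fourier_integrand g n) z).
{ intros z; destruct (Hg (cexp z) (cexp_neq_0 z)) as [l Hl].
  assert (D1 := @is_derive_comp C_AbsRing CN g cexp z _ _ Hl (is_derive_cexp z)).
  assert (D2 : @is_derive C_AbsRing CN (fun w => ZtoC (- n) * w)%C z
     (ZtoC (- n) * 1)%C).
  { rewrite Cmult_1_r; apply is_derive_Cmult_l. }
  assert (D3 := @is_derive_comp C_AbsRing CN cexp _ z _ _ (is_derive_cexp _) D2).
  eexists; exact (@is_derive_mult C_AbsRing _ _ z _ _ D1 D3 Cmult_comm). }
generalize (goursat _ Hd a b 0 (2 * PI) Hab ltac:(generalize PI_RGT_0; lra)).
unfold rect_int.
rewrite (CInt_ext (fun x => fourier_integrand g n (x, 2 * PI))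
  (fun x => fourier_integrand g n (x, 0))).
2: { intros x; rewrite <- (fourier_integrand_periodic g n (x, 0)); f_equal.
  apply injective_projections; simpl; ring. }
intros E.
assert (F : forall x, fourier_int g n (RtoC x)
   = CInt (fun t => fourier_integrand g n (x, t)) 0 (2 * PI)).
{ intros x; apply CInt_ext; intros t; f_equal.
  apply injective_projections; simpl; ring. }
rewrite !F.
set (A := CInt (fun t => fourier_integrand g n (a, t)) 0 (2 * PI)) in *.
set (B := CInt (fun t => fourier_integrand g n (b, t)) 0 (2 * PI)) in *.
set (Z := CInt (fun t => fourier_integrand g n (t, 0)) a b) in *.
transitivity (A + (- Ci) * RtoC 0)%C; [ring |].
rewrite <- E; replace (- Ci * (Z - Z + Ci * (B - A)))%C with (- (Ci * Ci) * (B - A))%C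
  by ring.
replace (Ci * Ci)%C with (- RtoC 1)%C by (apply injective_projections; simpl; ring).
ring.
Qed.

Lemma fourier_int_invariant g n w : hol_off_0 g ->
  fourier_int g n w = fourier_int g n (RtoC 0).
Proof.
intros Hg; destruct w as [x y].
replace (x, y) with (RtoC x + (imag y))%C by (apply injective_projections; simpl; ring).
rewrite fourier_int_vertical by apply hol_cont_off_0, Hg.
destruct (Rle_dec x 0) as [H | H]; [| symmetry];
 apply fourier_int_horizontal; auto; lra.
Qed.

Lemma laurent_fourier_int g n :
  laurent g n = (RtoC (/ (2 * PI)) * fourier_int g n (RtoC 0))%C.
Proof.
unfold laurent; f_equal; apply CInt_ext; intros t; unfold fourier_integrand.
rewrite Cplus_0_l; reflexivity.
Qed.

(** The coefficients do not depend on the circle over which they are taken: composing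
    [g] with the dilation by e^w multiplies the [n]-th one by e^{nw}, as it does for
    the monomial z^n. *)
Lemma laurent_rescale g n w : hol_off_0 g ->
  laurent (fun u => g (cexp w * u))%C n = (laurent g n * cexp (ZtoC n * w))%C.
Proof.
intros Hg; rewrite (laurent_fourier_int g n), <- (fourier_int_invariant g n w Hg).
unfold laurent.
rewrite <- Cmult_assoc, (Cmult_comm (fourier_int g n w)); f_equal.
unfold fourier_int; rewrite <- CInt_scal by apply path_fourier_integrand, hol_cont_off_0, Hg.
apply CInt_ext; intros t; unfold fourier_integrand.
rewrite !cexp_plus, Cmult_plus_distr_l, cexp_plus, opp_IZR, RtoC_opp.
replace (- ZtoC n * w)%C with (- (ZtoC n * w))%C by ring.
generalize (cexp_opp_r (ZtoC n * w)); intros E.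
transitivity (g (cexp w * cexp (imag t)) * cexp (- ZtoC n * imag t) * 1)%C; [ring |].
rewrite <- E; ring.
Qed.

Lemma Cmod_cexp_circle (n : Z) t : Cmod (cexp (ZtoC n * imag t)) = 1.
Proof.
rewrite Cmod_cexp; rewrite <- exp_0; f_equal; unfold Re; simpl; ring.
Qed.

Lemma path_laurent g n : cont_off_0 g ->
  path (fun t => g (cexp (imag t)) * cexp (ZtoC n * imag t))%C.
Proof.
intros Hg; generalize (path_fourier_integrand g (- n) 0 Hg); intros P t.
apply continuous_ext with (2 := P t); intros s; unfold fourier_integrand.
rewrite Cplus_0_l, Z.opp_involutive; reflexivity.
Qed.

Lemma laurent_bound_1 g n M : cont_off_0 g ->
  (forall z, Cmod z = 1 -> Cmod (g z) <= M) -> Cmod (laurent g n) <= 2 * M.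
Proof.
intros Hg HM; assert (Hpi := PI_RGT_0); unfold laurent.
assert (0 < / (2 * PI)) by (apply Rinv_0_lt_compat; lra).
rewrite Cmod_mult, Cmod_R, Rabs_pos_eq by lra.
apply Rle_trans with (/ (2 * PI) * (2 * (2 * PI - 0) * M)); [| right; field; lra].
apply Rmult_le_compat_l; [lra |]; apply CInt_bound; [| lra |].
- apply path_laurent, Hg.
- intros t _; rewrite Cmod_mult, Cmod_cexp_circle, Rmult_1_r; apply HM.
  rewrite Cmod_cexp; simpl; apply exp_0.
Qed.

Lemma hol_rescale g w : hol_off_0 g -> hol_off_0 (fun u => g (cexp w * u))%C.
Proof.
intros Hg z Hz.
apply (@ex_derive_comp C_AbsRing CN g (fun u => cexp w * u)%C).
- apply Hg, Cmult_neq_0; [apply cexp_neq_0 | exact Hz].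
- eexists; apply is_derive_Cmult_l.
Qed.

(** Cauchy's estimate: rescale the circle of radius e^x to the unit circle. *)
Lemma laurent_bound g n x M : hol_off_0 g ->
  (forall z, Cmod z = exp x -> Cmod (g z) <= M) ->
  Cmod (laurent g n) <= 2 * exp (- IZR n * x) * M.
Proof.
intros Hg HM.
assert (E : laurent g n
  = (laurent (fun u => g (cexp (RtoC x) * u)) n * cexp (- (ZtoC n * RtoC x)))%C).
{ rewrite laurent_rescale by exact Hg.
  rewrite <- Cmult_assoc, cexp_opp_r; ring. }
rewrite E, Cmod_mult, Cmod_cexp.
replace (Re (- (ZtoC n * RtoC x))) with (- IZR n * x) by (unfold Re; simpl; ring).
replace (2 * exp (- IZR n * x) * M) with (2 * M * exp (- IZR n * x)) by ring.
apply Rmult_le_compat_r; [left; apply exp_pos |].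
apply laurent_bound_1; [apply hol_cont_off_0, hol_rescale, Hg |].
intros z Hz; apply HM; rewrite Cmod_mult, Hz, Cmod_cexp; simpl; ring.
Qed.

Lemma half_period_sign (n : Z) : n <> 0%Z ->
  cexp (ZtoC (- n) * (imag (PI / IZR n))) = (- RtoC 1)%C.
Proof.
intros Hn; assert (IZR n <> 0) by (apply not_0_IZR; exact Hn).
unfold cexp; rewrite opp_IZR; simpl.
replace (- IZR n * 0 - 0 * (PI / IZR n)) with 0 by ring.
replace (- IZR n * (PI / IZR n) + 0 * 0) with (- PI) by (field; auto).
rewrite exp_0, cos_neg, sin_neg, cos_PI, sin_PI.
apply injective_projections; simpl; ring.
Qed.

(** A shift by half a period of the exponential changes its sign. *)
Lemma laurent_half_period g n : cont_off_0 g -> n <> 0%Z ->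
  laurent g n = (- (RtoC (/ (2 * PI)) * CInt (fun t => g (cexp (imag (t + PI / IZR n)))
    * cexp (ZtoC (- n) * imag t)) 0 (2 * PI)))%C.
Proof.
intros Hg Hn; rewrite laurent_fourier_int.
rewrite <- (fourier_int_vertical g n 0 (PI / IZR n)) by exact Hg.
unfold fourier_int.
transitivity (RtoC (/ (2 * PI)) * (- RtoC 1 * CInt (fun t => g (cexp (imag (t + PI / IZR n)))
    * cexp (ZtoC (- n) * imag t)) 0 (2 * PI)))%C; [f_equal | ring].
rewrite <- CInt_scal.
- apply CInt_ext; intros t; unfold fourier_integrand.
  rewrite <- (half_period_sign n Hn).
  replace (0 + (imag (PI / IZR n)) + imag t)%C with (imag (t + PI / IZR n))
    by (apply injective_projections; simpl; ring).
  replace (cexp (ZtoC (- n) * (imag (t + PI / IZR n))))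
    with (cexp (ZtoC (- n) * imag t) * cexp (ZtoC (- n) * (imag (PI / IZR n))))%C; [ring |].
  rewrite <- cexp_plus; f_equal; apply injective_projections; simpl; ring.
- apply path_mult.
  + generalize (path_circle g (imag (PI / IZR n)) Hg); intros P t.
    apply continuous_ext with (2 := P t); intros s; f_equal; f_equal.
    apply injective_projections; simpl; ring.
  + intros t; apply continuous_ext with (2 := path_cexp_line (ZtoC (- n)) 0 t).
    intros s; rewrite Cplus_0_l; reflexivity.
Qed.

Lemma laurent_const c n : laurent (fun _ => c) n = if Z.eq_dec n 0 then c else RtoC 0.
Proof.
assert (Hc : cont_off_0 (fun _ => c)) by (intros z _; exact (@continuous_const CN CN c z)).
destruct (Z.eq_dec n 0) as [-> | Hn].
- unfold laurent; rewrite (CInt_ext _ (fun _ => c)).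
  + rewrite CInt_const, Rminus_0_r, Cmult_assoc, <- RtoC_mult, Rinv_l; [ring |].
    generalize PI_RGT_0; lra.
  + intros t; replace (ZtoC (- 0) * imag t)%C with (RtoC 0)
      by (apply injective_projections; simpl; ring).
    rewrite cexp_0; ring.
- generalize (laurent_half_period _ n Hc Hn); cbv beta; fold (laurent (fun _ => c) n).
  intros E; apply injective_projections; apply (f_equal fst) in E as E1;
    apply (f_equal snd) in E as E2; simpl in *; lra.
Qed.

(** Adding the two expressions of [laurent_half_period] leaves an integral of
    differences of [g] at nearby points of the circle, which are small by uniform
    continuity. *)
Lemma riemann_lebesgue g eps : cont_off_0 g -> 0 < eps -> exists N, forall n,
  (N <= Z.abs n)%Z -> Cmod (laurent g n) <= eps.
Proof.
intros Hg Heps; assert (Hpi := PI_RGT_0).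
assert (Hq : path (fun t => g (cexp (imag t)))).
{ generalize (path_circle g 0 Hg); intros P t.
  apply continuous_ext with (2 := P t); intros s; rewrite Cplus_0_l; reflexivity. }
(* The interval contains [0, 2 pi] and its translates by at most pi. *)
destruct (@unifcont_normed_1d C_AbsRing CN (fun t => g (cexp (imag t)))
  (- PI) (3 * PI) (fun t _ => Hq t) (mkposreal eps Heps)) as [delta Hdelta].
destruct (archimed (PI / delta)) as [HN _].
set (N0 := up (PI / delta)) in *.
exists (Z.max 1 N0); intros n Hn.
assert (Hn0 : n <> 0%Z) by lia.
assert (Hd : 0 < delta) by apply cond_pos.
assert (Habs : PI / delta < Rabs (IZR n)).
{ rewrite <- abs_IZR; eapply Rlt_le_trans; [exact HN | apply IZR_le; lia]. }
assert (Habs1 : 1 <= Rabs (IZR n)) by (rewrite <- abs_IZR; apply IZR_le; lia).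
set (s := PI / IZR n).
assert (Hs : Rabs s < delta /\ Rabs s <= PI).
{ assert (Es : Rabs s * Rabs (IZR n) = PI).
  { rewrite <- Rabs_mult; unfold s.
    replace (PI / IZR n * IZR n) with PI by (field; apply not_0_IZR, Hn0).
    apply Rabs_pos_eq; lra. }
  assert (E2 : PI / delta * delta = PI) by (field; lra).
  generalize (Rabs_pos s); split; nra. }
apply Rmult_le_reg_l with 2; [lra |].
rewrite <- (Rabs_pos_eq 2), <- Cmod_R, <- Cmod_mult by lra.
replace (RtoC 2 * laurent g n)%C with (laurent g n + laurent g n)%C by ring.
rewrite (laurent_half_period g n Hg Hn0) at 2; fold s; unfold laurent.
assert (P1 : path (fun t => cexp (ZtoC (- n) * imag t))).
{ intros t; apply continuous_ext with (2 := path_cexp_line (ZtoC (- n)) 0 t).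
  intros u; rewrite Cplus_0_l; reflexivity. }
assert (P2 : path (fun t => g (cexp (imag (t + s))))).
{ generalize (path_circle g (imag s) Hg); intros P t.
  apply continuous_ext with (2 := P t); intros u; f_equal; f_equal.
  apply injective_projections; simpl; ring. }
assert (P3 : path (fun t => - RtoC 1 * (g (cexp (imag (t + s))) * cexp (ZtoC (- n) * imag t)))%C).
{ apply path_mult; [apply path_const | apply path_mult; assumption]. }
match goal with |- Cmod (?p * ?A + - (?p * ?B)) <= _ =>
  replace (p * A + - (p * B))%C with (p * (A + - RtoC 1 * B))%C by ring end.
rewrite <- CInt_scal by (apply path_mult; assumption).
rewrite <- CInt_plus by (exact P3 || (apply path_mult; assumption)).
assert (0 < / (2 * PI)) by (apply Rinv_0_lt_compat; lra).
rewrite Cmod_mult, !Cmod_R, !Rabs_pos_eq by lra.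
apply Rle_trans with (/ (2 * PI) * (2 * (2 * PI - 0) * eps)); [| right; field; lra].
apply Rmult_le_compat_l; [lra |]; apply CInt_bound; [| lra |].
- apply path_plus; [apply path_mult; assumption | exact P3].
- intros t Ht.
  replace (g (cexp (imag t)) * cexp (ZtoC (- n) * imag t)
    + - RtoC 1 * (g (cexp (imag (t + s))) * cexp (ZtoC (- n) * imag t)))%C
   with (- (g (cexp (imag (t + s))) - g (cexp (imag t))) * cexp (ZtoC (- n) * imag t))%C by ring.
  rewrite Cmod_mult, Cmod_cexp_circle, Rmult_1_r, Cmod_opp; left.
  destruct Hs as [Hs1 Hs2]; apply Rabs_le_between in Hs2.
  apply (Hdelta t (t + s)); [lra | lra |].
  change (Rabs (t + s - t) < delta); replace (t + s - t) with s by ring; exact Hs1.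
Qed.

(** * Convergence of the Laurent series *)

(** The difference quotient of [g] at 1, continued by the derivative [l]. *)
Definition quotient (g : C -> C) (l : C) (z : C) : C :=
  if Ceq_dec z (RtoC 1) then l else ((g z - g (RtoC 1)) * / (z - RtoC 1))%C.

Lemma quotient_spec g l z : g z = (g (RtoC 1) + (z - RtoC 1) * quotient g l z)%C.
Proof.
unfold quotient; destruct (Ceq_dec z (RtoC 1)) as [-> | H]; [ring |].
field; intros E; apply H.
replace z with ((z - 1) + 1)%C by ring; rewrite E; ring.
Qed.

Lemma quotient_cont g l : hol_off_0 g ->
  @is_derive C_AbsRing CN g (RtoC 1) l -> cont_off_0 (quotient g l).
Proof.
intros Hg Hl z Hz.
destruct (Ceq_dec z (RtoC 1)) as [-> | Hz1].
- apply (filterlim_locally (F := @locally CN (RtoC 1))); intros eps.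
  destruct (proj1 (@is_derive_C_eps CN g _ l) Hl (eps / 2)) as [d [Hd B]].
  { generalize (cond_pos eps); lra. }
  exists (mkposreal d Hd); intros w Hw.
  change (Cmod (quotient g l w - quotient g l (RtoC 1)) < eps).
  assert (He := cond_pos eps).
  unfold quotient at 2; destruct (Ceq_dec (RtoC 1) (RtoC 1)) as [_ | E];
   [| elim E; reflexivity].
  unfold quotient; destruct (Ceq_dec w (RtoC 1)) as [_ | Hw1].
  { replace (l - l)%C with (RtoC 0) by ring; rewrite Cmod_0; exact He. }
  assert (Hw0 : (w - 1)%C <> RtoC 0).
  { intros E; apply Hw1; replace w with ((w - 1) + 1)%C by ring; rewrite E; ring. }
  assert (Hm : 0 < Cmod (w - 1)) by (apply Cmod_gt_0; exact Hw0).
  specialize (B w Hw).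
  change (Cmod (g w - g (RtoC 1) - (w - 1) * l) <= eps / 2 * Cmod (w - 1)) in B.
  replace ((g w - g (RtoC 1)) * / (w - 1) - l)%C
   with ((g w - g (RtoC 1) - (w - 1) * l) * / (w - 1))%C by (field; exact Hw0).
  rewrite Cmod_mult, Cmod_inv by exact Hw0.
  apply Rle_lt_trans with (eps / 2); [| lra].
  apply Rmult_le_reg_r with (Cmod (w - 1)); [exact Hm |].
  rewrite Rmult_assoc, Rinv_l, Rmult_1_r; lra.
- assert (Hz0 : (z - 1)%C <> RtoC 0).
  { intros E; apply Hz1; replace z with ((z - 1) + 1)%C by ring; rewrite E; ring. }
  apply (@continuous_ext_loc CN CN (quotient g l) (fun w => (g w - g (RtoC 1)) * / (w - RtoC 1))%C).
  + assert (Hm : 0 < Cmod (z - 1)) by (apply Cmod_gt_0; exact Hz0).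
    exists (mkposreal _ Hm); intros w Hw.
    change (Cmod (w - z) < Cmod (z - 1)) in Hw.
    unfold quotient; destruct (Ceq_dec w (RtoC 1)) as [-> | _]; [| reflexivity].
    exfalso; rewrite <- Cmod_opp in Hw; apply (Rlt_irrefl (Cmod (z - 1))).
    replace (- (1 - z))%C with (z - 1)%C in Hw by ring; exact Hw.
  + assert (Cc : forall c, @continuous CN CN (fun _ => c) z)
      by (intros c; apply (@continuous_const CN CN)).
    apply (@continuous_mult CN C_AbsRing).
    * apply (@continuous_minus CN C_AbsRing CN); [| apply Cc].
      apply (hol_cont_off_0 g Hg z Hz).
    * apply (@continuous_comp CN CN CN (fun w => w - RtoC 1)%C Cinv).
      -- apply (@continuous_minus CN C_AbsRing CN); [apply continuous_id | apply Cc].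
      -- apply (@ex_derive_continuous C_AbsRing CN).
         eexists; apply is_derive_Cinv, Hz0.
Qed.

(** Multiplication by z shifts the coefficients, so that the factor z - 1 in
    [quotient_spec] turns them into differences. *)
Lemma laurent_quotient g l n : hol_off_0 g ->
  @is_derive C_AbsRing CN g (RtoC 1) l ->
  laurent g n = ((if Z.eq_dec n 0 then g (RtoC 1) else RtoC 0)
    + (laurent (quotient g l) (n - 1) - laurent (quotient g l) n))%C.
Proof.
intros Hg Hl; assert (Hq := quotient_cont g l Hg Hl).
rewrite <- laurent_const; unfold laurent.
assert (Hc : cont_off_0 (fun _ => g (RtoC 1)))
  by (intros z _; exact (@continuous_const CN CN (g (RtoC 1)) z)).
assert (P1 := path_laurent _ (- n) Hc).
assert (P2 := path_laurent _ (- (n - 1)) Hq).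
assert (P3 := path_laurent _ (- n) Hq).
cbv beta in P1.
assert (P4 : path (fun t => - RtoC 1 * (quotient g l (cexp (imag t)) * cexp (ZtoC (- n) * imag t)))%C)
  by (apply path_mult; [apply path_const | exact P3]).
assert (P5 := path_plus _ _ P2 P4).
match goal with |- (?p * _ = ?p * ?A + (?p * ?B - ?p * ?D))%C =>
  replace (p * A + (p * B - p * D))%C with (p * (A + (B + - RtoC 1 * D)))%C by ring end.
f_equal.
rewrite <- CInt_scal by exact P3.
rewrite <- (CInt_plus _ _ _ _ P2 P4), <- (CInt_plus _ _ _ _ P1 P5).
apply CInt_ext; intros t; rewrite (quotient_spec g l (cexp (imag t))) at 1.
replace (cexp (ZtoC (- (n - 1)) * imag t)) with (cexp (ZtoC (- n) * imag t) * cexp (imag t))%C; [ring |].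
rewrite <- cexp_plus; f_equal.
replace (- (n - 1))%Z with (- n + 1)%Z by ring; rewrite plus_IZR, RtoC_plus; ring.
Qed.

(** The slot for [k = 0] is empty, so that the constant coefficient of a Laurent
    series is counted once. *)
Definition neg_part {V : NormedModule C_AbsRing} (a : Z -> V) (k : nat) : V :=
  match k with O => zero | S _ => a (- Z.of_nat k)%Z end.

(** The sum over the indices from -m to m telescopes to the coefficients of the
    quotient at -m-1 and m, which vanish in the limit. *)
Lemma laurent_sum_1 g : hol_off_0 g ->
  @is_series C_AbsRing CN (fun k => laurent g (Z.of_nat k) + @neg_part CN (laurent g) k)%C (g (RtoC 1)).
Proof.
intros Hg; destruct (Hg (RtoC 1) C1_nz) as [l Hl].
assert (Hq := quotient_cont g l Hg Hl); set (d := laurent (quotient g l)).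
assert (HS : forall m, @sum_n CN (fun k => laurent g (Z.of_nat k) + @neg_part CN (laurent g) k)%C m
  = (g (RtoC 1) + (d (- Z.of_nat (S m))%Z - d (Z.of_nat m)))%C).
{ induction m as [| m IH].
  - rewrite sum_O; unfold neg_part; change (@zero CN) with (RtoC 0); rewrite (laurent_quotient g l) by auto; fold d.
    simpl Z.of_nat; destruct (Z.eq_dec 0 0) as [_ | E]; [| elim E; reflexivity].
    simpl; ring.
  - rewrite sum_Sn, IH.
    change (@plus CN) with Cplus; unfold neg_part.
    rewrite !(laurent_quotient g l) by auto; fold d.
    destruct (Z.eq_dec (Z.of_nat (S m)) 0) as [E | _]; [lia |].
    destruct (Z.eq_dec (- Z.of_nat (S m)) 0) as [E | _]; [lia |].
    replace (Z.of_nat (S m) - 1)%Z with (Z.of_nat m) by lia.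
    replace (- Z.of_nat (S m) - 1)%Z with (- Z.of_nat (S (S m)))%Z by lia.
    match goal with |- @eq _ ?a ?b => change (@eq C a b) end.
    change (@zero CN) with (RtoC 0); ring. }
apply (@filterlim_locally_ball_norm C_AbsRing nat CN); [apply eventually_filter |].
intros eps; assert (He := cond_pos eps).
destruct (riemann_lebesgue _ (eps / 3) Hq ltac:(lra)) as [N HN].
exists (Z.to_nat N); intros m Hm.
change (Cmod (@sum_n CN (fun k => laurent g (Z.of_nat k) + @neg_part CN (laurent g) k)%C m
   - g (RtoC 1)) < eps).
rewrite HS; fold d in HN.
replace (g (RtoC 1) + (d (- Z.of_nat (S m))%Z - d (Z.of_nat m)) - g (RtoC 1))%C
  with (d (- Z.of_nat (S m))%Z + - d (Z.of_nat m))%C by ring.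
eapply Rle_lt_trans; [apply Cmod_triangle |]; rewrite Cmod_opp.
generalize (HN (- Z.of_nat (S m))%Z ltac:(lia)), (HN (Z.of_nat m) ltac:(lia)); lra.
Qed.

(** The case z = 1 for the function that is dilated by z. *)
Theorem laurent_series g z : hol_off_0 g -> z <> RtoC 0 ->
  @is_series C_AbsRing CN
    (fun k => laurent g (Z.of_nat k) * Cpow z k + @neg_part CN (laurent g) k * Cpow (/ z) k)%C (g z).
Proof.
intros Hg Hz; destruct (cexp_surj z Hz) as [w [<- _]].
generalize (laurent_sum_1 _ (hol_rescale g w Hg)); rewrite Cmult_1_r.
apply (@is_series_ext C_AbsRing CN); intros k.
rewrite laurent_rescale, cexp_nat by exact Hg; f_equal.
destruct k as [| k]; unfold neg_part; [change (@zero CN) with (RtoC 0); simpl; ring |].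
rewrite laurent_rescale, cexp_opp_nat by exact Hg; reflexivity.
Qed.

(** * Completeness by sequences *)

Definition norm_cauchy {V : NormedModule C_AbsRing} (u : nat -> V) : Prop :=
  forall eps, 0 < eps -> exists N : nat, forall i j : nat,
    (N <= i)%nat -> (N <= j)%nat -> norm (minus (u i) (u j)) < eps.

Definition norm_limit {V : NormedModule C_AbsRing} (u : nat -> V) (l : V) : Prop :=
  forall eps, 0 < eps -> exists N : nat, forall i : nat,
    (N <= i)%nat -> norm (minus (u i) l) < eps.

Definition seq_complete (V : NormedModule C_AbsRing) : Prop :=
  forall u : nat -> V, norm_cauchy u -> exists l, norm_limit u l.

Lemma minus_plus_r {G : AbelianGroup} (x y z : G) :
  minus (plus x z) (plus y z) = minus x y.
Proof.
unfold minus; rewrite opp_plus, <- plus_assoc; f_equal.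
rewrite plus_comm, <- plus_assoc, plus_opp_l; apply plus_zero_r.
Qed.

Lemma norm_scal_C {V : NormedModule C_AbsRing} (a : C) (x : V) :
  norm (scal (a : C_AbsRing) x) = Cmod a * norm x.
Proof.
apply Rle_antisym; [apply (norm_scal (a : C_AbsRing) x) |].
destruct (Ceq_dec a 0) as [-> | Ha].
- rewrite Cmod_0, Rmult_0_l; apply norm_ge_0.
- assert (Hm : 0 < Cmod a) by (apply Cmod_gt_0; exact Ha).
  apply Rmult_le_reg_l with (/ Cmod a); [apply Rinv_0_lt_compat; exact Hm |].
  rewrite <- Rmult_assoc, Rinv_l, Rmult_1_l by lra.
  rewrite <- Cmod_inv by exact Ha.
  replace x with (scal (/ a : C_AbsRing)%C (scal (a : C_AbsRing) x)) at 1.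
  + apply (norm_scal (/ a : C_AbsRing)%C).
  + rewrite scal_assoc; change (mult (/ a : C_AbsRing)%C (a : C_AbsRing)) with (/ a * a)%C.
    rewrite Cinv_l by exact Ha; apply (@scal_one C_AbsRing V).
Qed.

Lemma norm_minus_sym {V : NormedModule C_AbsRing} (x y : V) :
  norm (minus x y) = norm (minus y x).
Proof. rewrite <- (norm_opp (minus y x)), opp_minus; reflexivity. Qed.

Lemma norm_minus_trans {V : NormedModule C_AbsRing} (x y z : V) :
  norm (minus x z) <= norm (minus x y) + norm (minus y z).
Proof. rewrite (minus_trans y x z); apply norm_triangle. Qed.

Lemma norm_le_minus {V : NormedModule C_AbsRing} (x y : V) :
  norm y <= norm x + norm (minus x y).
Proof.
replace y with (minus x (minus x y)) at 1.
- unfold minus at 1; eapply Rle_trans; [apply norm_triangle |].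
  rewrite norm_opp; apply Rle_refl.
- unfold minus; rewrite (@opp_plus V), (@opp_opp V), plus_assoc, (@plus_opp_r V); apply plus_zero_l.
Qed.

Lemma norm_limit_eventually {V : NormedModule C_AbsRing} (u : nat -> V) l :
  norm_limit u l <-> filterlim u eventually (locally l).
Proof.
split.
- intros H; apply filterlim_locally_ball_norm.
  intros eps; destruct (H eps (cond_pos eps)) as [N HN]; exists N; exact HN.
- intros H eps Heps; apply (proj1 (filterlim_locally_ball_norm _ _) H (mkposreal eps Heps)).
Qed.

Section Packing.
Context (V : NormedModule C_AbsRing) (HV : seq_complete V).

(** Balls of radius 1/(m+1) that belong to the filter have centres that form a Cauchy
    sequence, and its limit is the limit of the filter. *)
Lemma cauchy_filter_limit (F : (V -> Prop) -> Prop) : ProperFilter F -> cauchy F ->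
  exists l : V, forall eps : posreal, F (ball l eps).
Proof.
intros HF Hc.
assert (Hn : forall m : nat, exists x : V, F (fun y => norm (minus y x) < / INR (S m))).
{ intros m; assert (Hm : 0 < / INR (S m) / @norm_factor _ V).
  { apply Rdiv_lt_0_compat; [apply Rinv_0_lt_compat, lt_0_INR; lia | apply norm_factor_gt_0]. }
  destruct (Hc (mkposreal _ Hm)) as [x Hx]; exists x.
  revert Hx; apply filter_imp; intros y Hy.
  replace (/ INR (S m)) with (@norm_factor _ V * (/ INR (S m) / @norm_factor _ V)).
  - apply (norm_compat2 x y (mkposreal _ Hm) Hy).
  - generalize (/ INR (S m)); intros p; field.
    apply Rgt_not_eq, norm_factor_gt_0. }
set (x := fun m => proj1_sig (constructive_indefinite_description _ (Hn m))).
assert (Hx : forall m, F (fun y => norm (minus y (x m)) < / INR (S m)))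
  by (intros m; exact (proj2_sig (constructive_indefinite_description _ (Hn m)))).
assert (Hsmall : forall eps, 0 < eps -> exists N, forall m, (N <= m)%nat -> / INR (S m) < eps).
{ intros eps He; destruct (archimed_cor1 eps He) as [N [HN HN0]].
  exists N; intros m Hm; eapply Rle_lt_trans; [| exact HN].
  apply Rinv_le_contravar; [apply lt_0_INR | apply le_INR]; lia. }
destruct (HV x) as [l Hl].
- intros eps He; destruct (Hsmall (eps / 2)) as [N HN]; [lra |].
  exists N; intros i j Hi Hj.
  destruct (filter_ex _ (filter_and _ _ (Hx i) (Hx j))) as [y [Hyi Hyj]].
  eapply Rle_lt_trans; [apply (norm_minus_trans _ y) |].
  rewrite (norm_minus_sym (x i)); generalize (HN i Hi), (HN j Hj); lra.
- exists l; intros eps; assert (He := cond_pos eps).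
  destruct (Hl (eps / 2)) as [N1 H1]; [lra |].
  destruct (Hsmall (eps / 2)) as [N2 H2]; [lra |].
  set (m := Nat.max N1 N2); generalize (Hx m); apply filter_imp; intros y Hy.
  apply (norm_compat1 l y).
  eapply Rle_lt_trans; [apply (norm_minus_trans _ (x m)) |].
  generalize (H1 m ltac:(lia)), (H2 m ltac:(lia)); lra.
Qed.

(** The choice depends only on the sets that belong to the filter, which makes
    [filter_limit_ext] hold. *)
Definition filter_limit (F : (V -> Prop) -> Prop) : V :=
  epsilon (inhabits (zero : V)) (fun l : V => forall eps : posreal, F (ball l eps)).

Lemma filter_limit_correct (F : (V -> Prop) -> Prop) : ProperFilter F -> cauchy F ->
  forall eps : posreal, F (ball (filter_limit F) eps).
Proof.
intros HF Hc; apply (epsilon_spec (inhabits (zero : V))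
  (fun l : V => forall eps : posreal, F (ball l eps))).
apply cauchy_filter_limit; assumption.
Qed.

Lemma filter_limit_ext (F G : (V -> Prop) -> Prop) : filter_le F G -> filter_le G F ->
  close (filter_limit F) (filter_limit G).
Proof.
intros H1 H2; replace G with F; [intros eps; apply ball_center |].
apply functional_extensionality; intros P; apply propositional_extensionality.
split; [apply H2 | apply H1].
Qed.

Definition complete_module : CompleteNormedModule C_AbsRing :=
  CompleteNormedModule.Pack C_AbsRing V
    (CompleteNormedModule.Class C_AbsRing V (NormedModule.class C_AbsRing V)
       (CompleteSpace.Mixin _ filter_limit filter_limit_correct filter_limit_ext)) V.

End Packing.

Lemma C_seq_complete : seq_complete CN.
Proof.
intros u Hu.
assert (K : forall p : C -> R, (forall z w : C, Rabs (p z - p w) <= Cmod (z - w)) ->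
  exists l : R, forall eps, 0 < eps -> exists N : nat, forall i, (N <= i)%nat ->
    Rabs (p (u i) - l) < eps).
{ intros p Hp; assert (Hc : ex_lim_seq_cauchy (fun i => p (u i))).
  { intros eps; destruct (Hu eps (cond_pos eps)) as [N HN].
    exists N; intros i j Hi Hj; eapply Rle_lt_trans; [apply Hp | apply (HN i j Hi Hj)]. }
  apply ex_lim_seq_cauchy_corr in Hc; destruct Hc as [l Hl]; exists l.
  intros eps He; apply is_lim_seq_spec in Hl.
  exact (Hl (mkposreal eps He)). }
destruct (K Re) as [x Hx]; [intros z w; apply (re_le_Cmod (z - w)) |].
destruct (K Im) as [y Hy]; [intros z w; apply (im_le_Cmod (z - w)) |].
exists (x, y); intros eps He.
destruct (Hx (eps / 2)) as [N1 H1]; [lra |]; destruct (Hy (eps / 2)) as [N2 H2]; [lra |].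
exists (Nat.max N1 N2); intros i Hi.
change (Cmod (u i - (x, y)) < eps).
eapply Rle_lt_trans; [apply Cmod_le_sum |].
generalize (H1 i ltac:(lia)), (H2 i ltac:(lia)); unfold Re, Im; simpl; unfold Rminus; lra.
Qed.

(** * Norms on spaces of finite dimension *)

Section FiniteDim.
Context {V : NormedModule C_AbsRing}.

Definition lin_comb (n : nat) (e : nat -> V) (a : nat -> C) : V :=
  sum_n_m (fun i => scal (a i : C_AbsRing) (e i)) 1 n.

Definition lin_indep (n : nat) (e : nat -> V) : Prop :=
  forall a, lin_comb n e a = zero -> forall i, (1 <= i <= n)%nat -> a i = RtoC 0.

Lemma lin_comb_S n e a :
  lin_comb (S n) e a = plus (lin_comb n e a) (scal (a (S n) : C_AbsRing) (e (S n))).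
Proof. unfold lin_comb; rewrite sum_n_Sm by lia; reflexivity. Qed.

Lemma lin_comb_ext n e a b : (forall i, (1 <= i <= n)%nat -> a i = b i) ->
  lin_comb n e a = lin_comb n e b.
Proof. intros E; apply sum_n_m_ext_loc; intros i Hi; rewrite E by exact Hi; reflexivity. Qed.

Lemma lin_comb_plus n e a b :
  lin_comb n e (fun i => a i + b i)%C = plus (lin_comb n e a) (lin_comb n e b).
Proof.
unfold lin_comb; rewrite <- sum_n_m_plus; apply sum_n_m_ext; intros i.
exact (@scal_distr_r C_AbsRing V (a i) (b i) (e i)).
Qed.

Lemma lin_comb_scal n e (c : C) a :
  lin_comb n e (fun i => c * a i)%C = scal (c : C_AbsRing) (lin_comb n e a).
Proof.
unfold lin_comb; rewrite <- (@sum_n_m_scal_l C_AbsRing V); apply sum_n_m_ext; intros i.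
symmetry; exact (@scal_assoc C_AbsRing V c (a i) (e i)).
Qed.

Lemma lin_comb_minus n e a b :
  lin_comb n e (fun i => a i - b i)%C = minus (lin_comb n e a) (lin_comb n e b).
Proof.
rewrite (lin_comb_ext n e _ (fun i => a i + (- RtoC 1) * b i)%C)
  by (intros; ring).
rewrite lin_comb_plus, lin_comb_scal; unfold minus; f_equal.
apply (@scal_opp_one C_AbsRing V).
Qed.

Lemma lin_comb_limit n e (a : nat -> nat -> C) (b : nat -> C) :
  (forall i, (1 <= i <= n)%nat -> @norm_limit CN (fun m => a m i) (b i)) ->
  norm_limit (fun m => lin_comb n e (a m)) (lin_comb n e b).
Proof.
intros H; apply norm_limit_eventually; induction n as [| n IH].
- unfold lin_comb; rewrite !sum_n_m_zero by lia.
  apply filterlim_ext with (fun _ => zero);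
   [intros m; rewrite sum_n_m_zero by lia; reflexivity | apply filterlim_const].
- rewrite lin_comb_S.
  apply filterlim_ext with
   (fun m => plus (lin_comb n e (a m)) (scal (a m (S n) : C_AbsRing) (e (S n)))).
  { intros m; rewrite lin_comb_S; reflexivity. }
  eapply filterlim_comp_2; [apply IH; intros i Hi; apply H; lia | | apply filterlim_plus].
  apply (filterlim_comp _ _ _ (fun m => a m (S n)) (fun k : C_AbsRing => scal k (e (S n)))
    eventually (@locally CN (b (S n)))).
  + apply (@norm_limit_eventually CN), H; lia.
  + apply (@filterlim_scal_l C_AbsRing V).
Qed.

Lemma norm_limit_unique_zero (u : nat -> V) l :
  norm_limit u l -> (forall m, norm (u m) <= / INR (S m)) -> l = zero.
Proof.
intros Hl Hu; apply norm_eq_zero, Rle_antisym; [| apply norm_ge_0].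
apply le_epsilon; intros eps He; rewrite Rplus_0_l.
destruct (Hl (eps / 2)) as [N1 H1]; [lra |].
destruct (archimed_cor1 (eps / 2)) as [N [HN HN0]]; [lra |].
set (m := Nat.max N1 N).
assert (Hm : / INR (S m) <= / INR N)
  by (apply Rinv_le_contravar; [apply lt_0_INR | apply le_INR]; lia).
replace l with (plus (minus l (u m)) (u m)).
- eapply Rle_trans; [apply norm_triangle |]; rewrite norm_minus_sym.
  generalize (H1 m ltac:(lia)), (Hu m); lra.
- unfold minus; rewrite <- plus_assoc, plus_opp_l; apply plus_zero_r.
Qed.

(** If the coordinates are bounded by the norm, Cauchy sequences of linear combinations
    have Cauchy coordinates. *)
Lemma coord_limits n e K : 0 < K ->
  (forall a i, (1 <= i <= n)%nat -> Cmod (a i) <= K * norm (lin_comb n e a)) ->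
  forall a : nat -> nat -> C, norm_cauchy (fun m => lin_comb n e (a m)) ->
  exists b : nat -> C, norm_limit (fun m => lin_comb n e (a m)) (lin_comb n e b).
Proof.
intros HK HB a Ha.
assert (Hex : forall i, exists l : C, (1 <= i <= n)%nat -> @norm_limit CN (fun m => a m i) l).
{ intros i; destruct (Compare_dec.le_dec 1 i) as [H1 | H1];
   [destruct (Compare_dec.le_dec i n) as [H2 | H2] |];
   [| exists (RtoC 0); lia | exists (RtoC 0); lia].
  destruct (C_seq_complete (fun m => a m i)) as [l Hl]; [| exists l; auto].
  intros eps He; destruct (Ha (eps / K)) as [N HN]; [apply Rdiv_lt_0_compat; lra |].
  exists N; intros p q Hp Hq.
  change (Cmod (a p i - a q i) < eps).
  eapply Rle_lt_trans; [apply (HB (fun i => a p i - a q i)%C); lia |].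
  rewrite lin_comb_minus.
  replace eps with (K * (eps / K)) by (field; lra).
  apply Rmult_lt_compat_l; auto. }
exists (fun i => proj1_sig (constructive_indefinite_description _ (Hex i))).
apply lin_comb_limit; intros i Hi.
exact (proj2_sig (constructive_indefinite_description _ (Hex i)) Hi).
Qed.

(** Induction on the dimension. By the induction hypothesis the span of the first
    [n] vectors is complete, hence closed, and so the last vector has a positive
    distance [delta] from it. This bounds the last coordinate by norm / delta, and the
    others by the induction hypothesis after the last term has been subtracted. *)
Lemma coord_bound n (e : nat -> V) : lin_indep n e -> exists K, 0 < K /\
  forall a i, (1 <= i <= n)%nat -> Cmod (a i) <= K * norm (lin_comb n e a).
Proof.
induction n as [| n IH]; intros Hind; [exists 1; split; [lra | intros; lia] |].
destruct IH as [K [HK HB]].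
{ intros a Ha i Hi.
  generalize (Hind (fun j => if Nat.eq_dec j (S n) then RtoC 0 else a j)); intros H.
  specialize (fun E => H E i).
  destruct (Nat.eq_dec i (S n)) as [E | _]; [lia |]; apply H; [| lia].
  rewrite lin_comb_S; destruct (Nat.eq_dec (S n) (S n)) as [_ | E]; [| lia].
  rewrite (lin_comb_ext n e _ a), Ha.
  - rewrite plus_zero_l; apply (@scal_zero_l C_AbsRing V).
  - intros j Hj; destruct (Nat.eq_dec j (S n)); [lia | reflexivity]. }
assert (Hdist : exists delta, 0 < delta /\
  forall a, delta <= norm (plus (lin_comb n e a) (e (S n)))).
{ destruct (classic (exists delta, 0 < delta /\
    forall a, delta <= norm (plus (lin_comb n e a) (e (S n))))) as [H | H]; [exact H | exfalso].
  (* Without such a distance a sequence in the span tends to minus the last vector. *)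
  assert (Hseq : forall m : nat, exists a, norm (plus (lin_comb n e a) (e (S n))) < / INR (S m)).
  { intros m; apply NNPP; intros Hno; apply H; exists (/ INR (S m)); split.
    - apply Rinv_0_lt_compat, lt_0_INR; lia.
    - intros a; apply Rnot_lt_le; intros Hlt; apply Hno; exists a; exact Hlt. }
  set (a := fun m => proj1_sig (constructive_indefinite_description _ (Hseq m))).
  assert (Ha : forall m, norm (plus (lin_comb n e (a m)) (e (S n))) < / INR (S m))
    by (intros m; exact (proj2_sig (constructive_indefinite_description _ (Hseq m)))).
  destruct (coord_limits n e K HK HB a) as [b Hb].
  - intros eps He; destruct (archimed_cor1 (eps / 2)) as [N [HN HN0]]; [lra |].
    exists N; intros i j Hi Hj.
    assert (Hs : forall m, (N <= m)%nat -> / INR (S m) < eps / 2).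
    { intros m Hm; eapply Rle_lt_trans; [| exact HN].
      apply Rinv_le_contravar; [apply lt_0_INR | apply le_INR]; lia. }
    replace (minus (lin_comb n e (a i)) (lin_comb n e (a j)))
     with (minus (plus (lin_comb n e (a i)) (e (S n))) (plus (lin_comb n e (a j)) (e (S n)))).
    + eapply Rle_lt_trans; [apply norm_triangle |]; rewrite norm_opp.
      generalize (Ha i), (Ha j), (Hs i Hi), (Hs j Hj); lra.
    + apply (minus_plus_r (G := V)).
  - assert (E : plus (lin_comb n e b) (e (S n)) = zero).
    { apply norm_limit_unique_zero with (fun m => plus (lin_comb n e (a m)) (e (S n)));
        [| intros m; left; apply Ha].
      intros eps He; destruct (Hb eps He) as [N HN]; exists N; intros i Hi.
      replace (minus (plus (lin_comb n e (a i)) (e (S n))) (plus (lin_comb n e b) (e (S n))))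
       with (minus (lin_comb n e (a i)) (lin_comb n e b)); [auto |].
      symmetry; apply (minus_plus_r (G := V)). }
    assert (E1 := Hind (fun j => if Nat.eq_dec j (S n) then RtoC 1 else b j)).
    specialize (fun E' => E1 E' (S n) ltac:(lia)); cbv beta in E1.
    rewrite lin_comb_S in E1.
    destruct (Nat.eq_dec (S n) (S n)) as [_ | E']; [| lia].
    apply C1_nz, E1; rewrite <- E; f_equal.
    + apply lin_comb_ext; intros j Hj; destruct (Nat.eq_dec j (S n)); [lia | reflexivity].
    + apply (@scal_one C_AbsRing V). }
destruct Hdist as [delta [Hdelta Hdist]].
set (E := norm (e (S n))); assert (HE : 0 <= E) by apply norm_ge_0.
(* Divide by the last coordinate and use the distance. *)
assert (Htop : forall a, Cmod (a (S n)) <= / delta * norm (lin_comb (S n) e a)).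
{ intros a; apply Rmult_le_reg_l with delta; [exact Hdelta |].
  rewrite <- Rmult_assoc, Rinv_r, Rmult_1_l by lra.
  destruct (Ceq_dec (a (S n)) 0) as [-> | Ht].
  { rewrite Cmod_0, Rmult_0_r; apply norm_ge_0. }
  replace (lin_comb (S n) e a) with (scal (a (S n) : C_AbsRing)
    (plus (lin_comb n e (fun i => / a (S n) * a i)%C) (e (S n)))).
  - rewrite norm_scal_C, Rmult_comm; apply Rmult_le_compat_l; [apply Cmod_ge_0 | apply Hdist].
  - rewrite (@scal_distr_l C_AbsRing V), lin_comb_S, <- lin_comb_scal; f_equal.
    apply lin_comb_ext; intros i _; field; exact Ht. }
assert (Hi : 0 < / delta) by (apply Rinv_0_lt_compat; exact Hdelta).
exists (/ delta + K * (1 + / delta * E)); split.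
{ apply Rplus_lt_0_compat; [exact Hi |]; apply Rmult_lt_0_compat; [exact HK |].
  generalize (Rmult_le_pos _ _ (Rlt_le _ _ Hi) HE); lra. }
intros a i Hin; set (v := lin_comb (S n) e a); assert (Hv : 0 <= norm v) by apply norm_ge_0.
assert (T := Htop a); fold v in T.
assert (HKE : 0 <= K * (1 + / delta * E)).
{ apply Rmult_le_pos; [lra |]; generalize (Rmult_le_pos _ _ (Rlt_le _ _ Hi) HE); lra. }
rewrite Rmult_plus_distr_r.
destruct (Nat.eq_dec i (S n)) as [-> | Hne].
{ generalize (Rmult_le_pos _ _ HKE Hv); lra. }
assert (B := HB a i ltac:(lia)).
assert (L : norm (lin_comb n e a) <= (1 + / delta * E) * norm v).
{ replace (lin_comb n e a) with (minus v (scal (a (S n) : C_AbsRing) (e (S n)))).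
  - eapply Rle_trans; [apply norm_triangle |]; rewrite norm_opp, norm_scal_C; fold E.
    apply Rle_trans with (norm v + (/ delta * norm v) * E); [| right; ring].
    apply Rplus_le_compat_l, Rmult_le_compat_r; assumption.
  - unfold v; rewrite lin_comb_S; unfold minus.
    rewrite <- plus_assoc, (@plus_opp_r V); apply plus_zero_r. }
generalize (Rmult_le_pos _ _ (Rlt_le _ _ Hi) Hv), (Rmult_le_compat_l K _ _ (Rlt_le _ _ HK) L).
lra.
Qed.

End FiniteDim.

Section Coordinates.
Context {V : NormedModule C_AbsRing}.

Lemma basis_coord n (e : nat -> V) : is_basis n e ->
  exists c : V -> nat -> C,
    (forall v, lin_comb n e (c v) = v) /\
    (forall a i, (1 <= i <= n)%nat -> c (lin_comb n e a) i = a i) /\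
    exists K, 0 < K /\
      forall v i, (1 <= i <= n)%nat -> Cmod (c v i) <= K * norm v.
Proof.
intros [Hspan Hind].
set (c := fun v => proj1_sig (constructive_indefinite_description _ (Hspan v))).
assert (Hc : forall v, lin_comb n e (c v) = v)
  by (intros v; symmetry; exact (proj2_sig (constructive_indefinite_description _ (Hspan v)))).
exists c; split; [exact Hc | split].
- intros a i Hi.
  assert (E : lin_comb n e (fun j => c (lin_comb n e a) j - a j)%C = zero).
  { rewrite lin_comb_minus, Hc; apply (@plus_opp_r V). }
  generalize (Hind _ E i Hi); cbv beta; intros E'.
  replace (c (lin_comb n e a) i) with ((c (lin_comb n e a) i - a i) + a i)%C by ring.
  rewrite E'; ring.
- destruct (coord_bound n e Hind) as [K [HK HB]]; exists K; split; [exact HK |].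
  intros v i Hi; rewrite <- (Hc v) at 2; apply HB, Hi.
Qed.

Lemma lin_comb_norm n (e : nat -> V) : exists E, 0 <= E /\
  forall a M, 0 <= M -> (forall i, (1 <= i <= n)%nat -> Cmod (a i) <= M) ->
    norm (lin_comb n e a) <= E * M.
Proof.
induction n as [| n [E [HE IH]]].
- exists 0; split; [lra |]; intros a M HM _; unfold lin_comb.
  rewrite sum_n_m_zero by lia; apply Rle_trans with 0; [right; exact (@norm_zero _ V) | lra].
- exists (E + norm (e (S n))); split.
  { generalize (norm_ge_0 (e (S n))); lra. }
  intros a M HM Ha; rewrite lin_comb_S, Rmult_plus_distr_r.
  eapply Rle_trans; [apply norm_triangle |]; apply Rplus_le_compat.
  + apply IH; [exact HM | intros i Hi; apply Ha; lia].
  + rewrite norm_scal_C, Rmult_comm; apply Rmult_le_compat_l;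
      [apply norm_ge_0 | apply Ha; lia].
Qed.

Lemma finite_dim_complete n : has_dim V n -> seq_complete V.
Proof.
intros [e He] u Hu.
destruct (basis_coord n e He) as [c [Hc _]].
destruct (coord_bound n e (proj2 He)) as [K [HK HB]].
destruct (coord_limits n e K HK HB (fun m => c (u m))) as [b Hb].
- intros eps Heps; destruct (Hu eps Heps) as [N HN]; exists N; intros i j Hi Hj.
  rewrite !Hc; auto.
- exists (lin_comb n e b); intros eps Heps; destruct (Hb eps Heps) as [N HN].
  exists N; intros i Hi; rewrite <- (Hc (u i)); apply HN, Hi.
Qed.

End Coordinates.

Lemma prod_seq_complete (U V : NormedModule C_AbsRing) :
  seq_complete U -> seq_complete V -> seq_complete (prod_NormedModule C_AbsRing U V).
Proof.
intros HU HV u Hu.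
destruct (HU (fun i => fst (u i))) as [x Hx].
{ intros eps He; destruct (Hu eps He) as [N HN]; exists N; intros i j Hi Hj.
  eapply Rle_lt_trans; [| apply (HN i j Hi Hj)].
  eapply Rle_trans; [apply Rmax_l | apply (norm_prod (minus (fst (u i)) (fst (u j)))
    (minus (snd (u i)) (snd (u j))))]. }
destruct (HV (fun i => snd (u i))) as [y Hy].
{ intros eps He; destruct (Hu eps He) as [N HN]; exists N; intros i j Hi Hj.
  eapply Rle_lt_trans; [| apply (HN i j Hi Hj)].
  eapply Rle_trans; [apply Rmax_r | apply (norm_prod (minus (fst (u i)) (fst (u j)))
    (minus (snd (u i)) (snd (u j))))]. }
assert (Hs : 0 < sqrt 2) by (apply sqrt_lt_R0; lra).
exists (x, y); intros eps He.
destruct (Hx (eps / sqrt 2)) as [N1 H1]; [apply Rdiv_lt_0_compat; lra |].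
destruct (Hy (eps / sqrt 2)) as [N2 H2]; [apply Rdiv_lt_0_compat; lra |].
exists (Nat.max N1 N2); intros i Hi.
eapply Rle_lt_trans; [apply (norm_prod (minus (fst (u i)) x) (minus (snd (u i)) y)) |].
replace eps with (sqrt 2 * (eps / sqrt 2)) by (field; lra).
apply Rmult_lt_compat_l; [exact Hs |]; apply Rmax_lub_lt; [apply H1 | apply H2]; lia.
Qed.

(** * Laurent coefficients of vector-valued maps *)

Lemma laurent_ext g h n : (forall z, g z = h z) -> laurent g n = laurent h n.
Proof. intros E; unfold laurent; f_equal; apply CInt_ext; intros t; rewrite E; reflexivity. Qed.

Lemma laurent_plus g h n : cont_off_0 g -> cont_off_0 h ->
  laurent (fun z => g z + h z)%C n = (laurent g n + laurent h n)%C.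
Proof.
intros Hg Hh; unfold laurent; rewrite <- Cmult_plus_distr_l.
rewrite <- (CInt_plus _ _ _ _ (path_laurent g _ Hg) (path_laurent h _ Hh)).
f_equal; apply CInt_ext; intros t; ring.
Qed.

Lemma laurent_scal c g n : cont_off_0 g ->
  laurent (fun z => c * g z)%C n = (c * laurent g n)%C.
Proof.
intros Hg; unfold laurent.
rewrite (CInt_ext _ (fun t => c * (g (cexp (imag t)) * cexp (ZtoC (- n) * imag t)))%C)
  by (intros; ring).
rewrite CInt_scal by apply path_laurent, Hg; ring.
Qed.

(** What the construction of the retract uses of the Laurent coefficients: they are
    linear, obey Cauchy's estimate up to a constant, and sum up to the map. *)
Record laurent_operator {V : NormedModule C_AbsRing} (K : R) (A : (C -> V) -> Z -> V)
  : Prop := {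
  lo_pos : 0 < K;
  lo_plus : forall f g n, derivable_off_0 f -> derivable_off_0 g ->
    A (fun z => plus (f z) (g z)) n = plus (A f n) (A g n);
  lo_scal : forall (c : C) f n, derivable_off_0 f ->
    A (fun z => scal (c : C_AbsRing) (f z)) n = scal (c : C_AbsRing) (A f n);
  lo_bound : forall f n x M, derivable_off_0 f ->
    (forall z, Cmod z = exp x -> norm (f z) <= M) ->
    norm (A f n) <= K * exp (- IZR n * x) * M;
  lo_series : forall f z, derivable_off_0 f -> z <> RtoC 0 ->
    is_series (fun k => plus (scal (Cpow z k : C_AbsRing) (A f (Z.of_nat k)))
      (scal (Cpow (/ z) k : C_AbsRing) (neg_part (A f) k))) (f z)
}.

(** Apply the scalar theory to the coordinates of the map in a basis. They are
    holomorphic and bounded by the map because they are bounded functionals. *)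
Theorem laurent_operator_finite_dim (V : NormedModule C_AbsRing) n : has_dim V n ->
  exists K (A : (C -> V) -> Z -> V), laurent_operator K A.
Proof.
intros [e He].
destruct (basis_coord n e He) as [c [Hc [Huniq [K [HK HB]]]]].
destruct (lin_comb_norm n e) as [E [HE Hnorm]].
assert (c_plus : forall v w i, (1 <= i <= n)%nat -> c (plus v w) i = (c v i + c w i)%C).
{ intros v w i Hi; rewrite <- (Hc v) at 1; rewrite <- (Hc w) at 1.
  rewrite <- lin_comb_plus; apply (Huniq (fun i => c v i + c w i)%C i Hi). }
assert (c_scal : forall (a : C) v i, (1 <= i <= n)%nat ->
  c (scal (a : C_AbsRing) v) i = (a * c v i)%C).
{ intros a v i Hi; rewrite <- (Hc v) at 1.
  rewrite <- lin_comb_scal; apply (Huniq (fun i => a * c v i)%C i Hi). }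
assert (c_minus : forall (v w : V) i, (1 <= i <= n)%nat -> c (minus v w) i = (c v i - c w i)%C).
{ intros v w i Hi; rewrite <- (Hc v) at 1; rewrite <- (Hc w) at 1.
  rewrite <- lin_comb_minus; apply (Huniq (fun i => c v i - c w i)%C i Hi). }
assert (Hhol : forall f i, (1 <= i <= n)%nat -> derivable_off_0 f ->
  hol_off_0 (fun z => c (f z) i)).
{ intros f i Hi Hf z Hz; destruct (Hf z Hz) as [l Hl]; exists (c l i).
  apply (@is_derive_C_eps CN); intros eps Heps.
  destruct (proj1 (is_derive_C_eps f z l) Hl (eps / K)) as [d [Hd B]];
    [apply Rdiv_lt_0_compat; lra |].
  exists d; split; [exact Hd |]; intros w Hw.
  change (Cmod (c (f w) i - c (f z) i - (w - z) * c l i) <= eps * Cmod (w - z)).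
  rewrite <- c_minus, <- c_scal, <- c_minus by exact Hi.
  eapply Rle_trans; [apply HB, Hi |].
  replace (eps * Cmod (w - z)) with (K * (eps / K * Cmod (w - z))) by (field; lra).
  apply Rmult_le_compat_l; [lra | apply B, Hw]. }
set (A := fun (f : C -> V) (m : Z) => lin_comb n e (fun i => laurent (fun z => c (f z) i) m)).
exists (2 * K * (E + 1)), A; split.
- apply Rmult_lt_0_compat; lra.
- intros f g m Hf Hg; unfold A; rewrite <- lin_comb_plus.
  apply lin_comb_ext; intros i Hi.
  rewrite <- laurent_plus by (apply hol_cont_off_0, Hhol; assumption).
  apply laurent_ext; intros z; apply c_plus, Hi.
- intros a f m Hf; unfold A; rewrite <- lin_comb_scal.
  apply lin_comb_ext; intros i Hi.
  rewrite <- laurent_scal by (apply hol_cont_off_0, Hhol; assumption).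
  apply laurent_ext; intros z; apply c_scal, Hi.
- intros f m x M Hf HM.
  assert (HM0 : 0 <= M).
  { apply Rle_trans with (norm (f (cexp (RtoC x)))); [apply norm_ge_0 | apply HM].
    rewrite Cmod_cexp; reflexivity. }
  assert (P : 0 <= 2 * exp (- IZR m * x) * (K * M)).
  { apply Rmult_le_pos; [generalize (exp_pos (- IZR m * x)); lra |].
    apply Rmult_le_pos; lra. }
  apply Rle_trans with (E * (2 * exp (- IZR m * x) * (K * M))).
  + apply Hnorm; [exact P |]; intros i Hi; apply laurent_bound; [apply Hhol; assumption |].
    intros z Hz; eapply Rle_trans; [apply HB, Hi |].
    apply Rmult_le_compat_l; [lra | apply HM, Hz].
  + replace (2 * K * (E + 1) * exp (- IZR m * x) * M)
      with ((E + 1) * (2 * exp (- IZR m * x) * (K * M))) by ring.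
    apply Rmult_le_compat_r; lra.
- intros f z Hf Hz; apply norm_limit_eventually.
  set (t := fun i k => (laurent (fun z => c (f z) i) (Z.of_nat k) * Cpow z k
     + @neg_part CN (laurent (fun z => c (f z) i)) k * Cpow (/ z) k)%C).
  assert (L := lin_comb_limit n e (fun m i => @sum_n CN (t i) m) (c (f z))).
  rewrite Hc in L.
  assert (Et : forall k, plus (scal (Cpow z k : C_AbsRing) (A f (Z.of_nat k)))
      (scal (Cpow (/ z) k : C_AbsRing) (neg_part (A f) k)) = lin_comb n e (fun i => t i k)).
  { intros k; assert (En : neg_part (A f) k
       = lin_comb n e (fun i => @neg_part CN (laurent (fun z => c (f z) i)) k)).
    { destruct k as [| k]; [| reflexivity]; simpl.
      rewrite (lin_comb_ext n e _ (fun i => RtoC 0 * RtoC 0)%C)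
        by (intros; symmetry; apply Cmult_0_l).
      rewrite lin_comb_scal; symmetry; apply (@scal_zero_l C_AbsRing V). }
    rewrite En; unfold A; rewrite <- !lin_comb_scal.
    etransitivity; [symmetry; apply (lin_comb_plus n e) |].
    apply lin_comb_ext; intros i Hi; unfold t; ring. }
  assert (Es : forall m, sum_n (fun k => plus (scal (Cpow z k : C_AbsRing) (A f (Z.of_nat k)))
      (scal (Cpow (/ z) k : C_AbsRing) (neg_part (A f) k))) m
      = lin_comb n e (fun i => @sum_n CN (t i) m)).
  { induction m as [| m IH].
    - rewrite sum_O, Et; apply lin_comb_ext; intros i Hi; rewrite sum_O; reflexivity.
    - rewrite sum_Sn, IH, Et; etransitivity; [symmetry; apply (lin_comb_plus n e) |].
      apply lin_comb_ext; intros i Hi.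
      rewrite sum_Sn; reflexivity. }
  intros eps Heps; destruct L with (eps := eps) as [N HN]; [| exact Heps |].
  + intros i Hi; apply (@norm_limit_eventually CN).
    apply (laurent_series (fun z => c (f z) i) z (Hhol f i Hi Hf) Hz).
  + exists N; intros m Hm; rewrite Es; apply HN, Hm.
Qed.

(** * Vector-valued power series *)

Lemma sum_n_le_Series (c : nat -> R) m : (forall k, 0 <= c k) -> ex_series c ->
  sum_n c m <= Series c.
Proof.
intros Hc Hs.
apply (is_lim_seq_incr_compare (sum_n c) (Series c)).
- apply (Series_correct c Hs).
- intros k; rewrite sum_Sn; unfold plus; simpl; generalize (Hc (S k)); lra.
Qed.

Lemma term_le_Series (c : nat -> R) k : (forall j, 0 <= c j) -> ex_series c ->
  c k <= Series c.
Proof.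
intros Hc Hs; eapply Rle_trans; [| apply (sum_n_le_Series c k Hc Hs)].
assert (H : forall j, 0 <= sum_n c j).
{ induction j as [| j IH]; [rewrite sum_O; apply Hc |].
  rewrite sum_Sn; unfold plus; simpl; generalize (Hc (S j)); lra. }
destruct k as [| k]; [rewrite sum_O; lra |].
rewrite sum_Sn; unfold plus; simpl; generalize (H k); lra.
Qed.

Lemma Series_nonneg (c : nat -> R) : (forall j, 0 <= c j) -> ex_series c -> 0 <= Series c.
Proof. intros H Hs; eapply Rle_trans; [apply (H 0%nat) | apply term_le_Series; assumption]. Qed.

Lemma ex_series_dominated (a c : nat -> R) : (forall k, 0 <= a k <= c k) -> ex_series c ->
  ex_series a.
Proof.
intros H; apply (@ex_series_le R_AbsRing R_CompleteNormedModule); intros k.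
change (Rabs (a k) <= c k); rewrite Rabs_pos_eq; apply H.
Qed.

Section VectorSeries.
Context {V : NormedModule C_AbsRing}.

Lemma series_norm_le (a : nat -> V) (c : nat -> R) l :
  is_series a l -> (forall k, norm (a k) <= c k) -> ex_series c -> norm l <= Series c.
Proof.
intros Hl Hac Hc.
assert (Hp : forall k, 0 <= c k)
  by (intros k; apply Rle_trans with (norm (a k)); [apply norm_ge_0 | apply Hac]).
apply le_epsilon; intros eps He.
destruct (proj2 (norm_limit_eventually (sum_n a) l) Hl eps He) as [N HN].
assert (Hs : norm (sum_n a N) <= sum_n c N).
{ generalize N; intros m; induction m as [| m IH]; [rewrite !sum_O; apply Hac |].
  rewrite !sum_Sn; eapply Rle_trans; [apply norm_triangle |].
  apply Rplus_le_compat; [exact IH | apply Hac]. }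
specialize (HN N (Nat.le_refl N)); rewrite norm_minus_sym in HN.
replace l with (plus (minus l (sum_n a N)) (sum_n a N)).
- eapply Rle_trans; [apply norm_triangle |].
  generalize (sum_n_le_Series c N Hp Hc); lra.
- unfold minus; rewrite <- plus_assoc, (@plus_opp_l V); apply plus_zero_r.
Qed.

Lemma series_unique (a : nat -> V) l m : is_series a l -> is_series a m -> l = m.
Proof. apply filterlim_locally_unique. Qed.

Lemma absolutely_convergent (HV : seq_complete V) (a : nat -> V) (c : nat -> R) :
  (forall k, norm (a k) <= c k) -> ex_series c -> exists l, is_series a l.
Proof. exact (@ex_series_le C_AbsRing (complete_module V HV) a c). Qed.

End VectorSeries.

Lemma exp_le x y : x <= y -> exp x <= exp y.
Proof. intros [H | ->]; [left; apply exp_increasing, H | right; reflexivity]. Qed.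

Lemma exp_mult_nat (x : R) (k : nat) : exp (x * INR k) = exp x ^ k.
Proof.
induction k as [| k IH]; [rewrite Rmult_0_r, exp_0; reflexivity |].
rewrite S_INR, Rmult_plus_distr_l, exp_plus, IH, Rmult_1_r; simpl; ring.
Qed.

Lemma exp_nat_unbounded r : exists m : nat, r <= exp (INR m).
Proof.
destruct (INR_unbounded r) as [m Hm]; exists m.
generalize (exp_ineq1_le (INR m)); lra.
Qed.

Section PowerSeries.
Context {V : NormedModule C_AbsRing} (HV : seq_complete V).

Definition power_sum (b : nat -> V) (z : C) : V :=
  epsilon (inhabits zero) (is_series (fun k => scal (Cpow z k : C_AbsRing) (b k))).

Lemma exp_weight_nonneg n (b : nat -> V) k : 0 <= exp_weight n b k.
Proof. apply Rmult_le_pos; [left; apply exp_pos | apply norm_ge_0]. Qed.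

Lemma ex_series_pow (b : nat -> V) r : exp_decreasing b -> 0 <= r ->
  ex_series (fun k => r ^ k * norm (b k)).
Proof.
intros Hb Hr; destruct (exp_nat_unbounded r) as [m Hm].
apply (ex_series_dominated _ (exp_weight m b)); [| apply Hb].
intros k; split; [apply Rmult_le_pos; [apply pow_le, Hr | apply norm_ge_0] |].
unfold exp_weight; rewrite exp_mult_nat.
apply Rmult_le_compat_r; [apply norm_ge_0 | apply pow_incr; lra].
Qed.

Lemma power_sum_correct b z : exp_decreasing b ->
  is_series (fun k => scal (Cpow z k : C_AbsRing) (b k)) (power_sum b z).
Proof.
intros Hb; unfold power_sum; apply epsilon_spec.
apply (absolutely_convergent HV _ (fun k => Cmod z ^ k * norm (b k))).
- intros k; rewrite norm_scal_C, Cmod_pow; lra.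
- apply ex_series_pow; [exact Hb | apply Cmod_ge_0].
Qed.

Lemma power_sum_unique b z l : exp_decreasing b ->
  is_series (fun k => scal (Cpow z k : C_AbsRing) (b k)) l -> power_sum b z = l.
Proof. intros Hb; apply series_unique, power_sum_correct, Hb. Qed.

Lemma power_sum_bound b z m : exp_decreasing b -> Cmod z <= exp (INR m) ->
  norm (power_sum b z) <= Series (exp_weight m b).
Proof.
intros Hb Hz; apply (series_norm_le _ _ _ (power_sum_correct b z Hb)); [| apply Hb].
intros k; rewrite norm_scal_C, Cmod_pow; unfold exp_weight; rewrite exp_mult_nat.
apply Rmult_le_compat_r; [apply norm_ge_0 | apply pow_incr].
split; [apply Cmod_ge_0 | exact Hz].
Qed.

(** The derivative k z^(k-1) of z^k, in the form given by the product rule, which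
    suits induction on [k]. *)
Fixpoint dpow (z : C) (k : nat) : C :=
  match k with O => RtoC 0 | S j => (z * dpow z j + Cpow z j)%C end.

Lemma dpow_bound z k : Cmod (dpow z k) <= (Cmod z + 1) ^ k.
Proof.
assert (Hz := Cmod_ge_0 z).
induction k as [| k IH]; simpl; [rewrite Cmod_0; lra |].
eapply Rle_trans; [apply Cmod_triangle |]; rewrite Cmod_mult, Cmod_pow.
assert (H1 : Cmod z ^ k <= (Cmod z + 1) ^ k) by (apply pow_incr; lra).
generalize (Rmult_le_compat_l _ _ _ Hz IH); lra.
Qed.

Lemma pow_taylor_bound z h k : Cmod h <= 1 ->
  Cmod (Cpow (z + h) k - Cpow z k - h * dpow z k) <= (Cmod h) ^ 2 * (Cmod z + 2) ^ k.
Proof.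
intros Hh; assert (Hz := Cmod_ge_0 z); assert (Hh0 := Cmod_ge_0 h).
induction k as [| k IH]; simpl Cpow; simpl dpow.
- replace (1 - 1 - h * 0)%C with (RtoC 0) by ring; rewrite Cmod_0; simpl; nra.
- replace ((z + h) * Cpow (z + h) k - z * Cpow z k - h * (z * dpow z k + Cpow z k))%C
   with ((z + h) * (Cpow (z + h) k - Cpow z k - h * dpow z k) + h * h * dpow z k)%C by ring.
  eapply Rle_trans; [apply Cmod_triangle |]; rewrite !Cmod_mult.
  assert (D := dpow_bound z k).
  assert (P : (Cmod z + 1) ^ k <= (Cmod z + 2) ^ k) by (apply pow_incr; lra).
  set (p := (Cmod z + 2) ^ k) in *.
  assert (Hp : 0 <= p) by (apply pow_le; lra).
  set (E := Cmod (Cpow (z + h) k - Cpow z k - h * dpow z k)) in *.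
  assert (HE : 0 <= E) by apply Cmod_ge_0.
  assert (T : Cmod (z + h) <= Cmod z + 1)
    by (eapply Rle_trans; [apply Cmod_triangle | lra]).
  apply Rle_trans with ((Cmod z + 1) * (Cmod h ^ 2 * p) + Cmod h * Cmod h * p).
  + apply Rplus_le_compat.
    * apply Rmult_le_compat; auto; apply Cmod_ge_0.
    * apply Rmult_le_compat_l; [apply Rmult_le_pos |]; lra.
  + change ((Cmod z + 2) ^ S k) with ((Cmod z + 2) * p); right; ring.
Qed.

(** Term by term, the error of the first-order expansion is at most
    |h|^2 (|z| + 2)^k ||b_k||, and this is summable over k since the coefficients
    decrease faster than every geometric sequence. *)
Lemma power_sum_derivable b z : exp_decreasing b ->
  @ex_derive C_AbsRing V (power_sum b) z.
Proof.
intros Hb; assert (Hz := Cmod_ge_0 z).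
destruct (absolutely_convergent HV (fun k => scal (dpow z k : C_AbsRing) (b k))
  (fun k => (Cmod z + 1) ^ k * norm (b k))) as [l Hl].
{ intros k; rewrite norm_scal_C; apply Rmult_le_compat_r;
    [apply norm_ge_0 | apply dpow_bound]. }
{ apply ex_series_pow; [exact Hb | lra]. }
exists l; apply is_derive_C_eps; intros eps Heps.
assert (Hc := ex_series_pow b (Cmod z + 2) Hb ltac:(lra)).
set (S := Series (fun k => (Cmod z + 2) ^ k * norm (b k))).
assert (HS : 0 <= S).
{ apply Series_nonneg; [| exact Hc]; intros k.
  apply Rmult_le_pos; [apply pow_le; lra | apply norm_ge_0]. }
exists (Rmin 1 (eps / (S + 1))); split.
{ apply Rmin_pos; [lra | apply Rdiv_lt_0_compat; lra]. }
intros w Hw; set (h := (w - z)%C) in *.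
assert (H1 : Cmod h < 1) by (eapply Rlt_le_trans; [exact Hw | apply Rmin_l]).
assert (H2 : Cmod h < eps / (S + 1)) by (eapply Rlt_le_trans; [exact Hw | apply Rmin_r]).
assert (Hh := Cmod_ge_0 h).
assert (Ew : (w = z + h)%C) by (unfold h; ring).
clearbody h; subst w.
assert (Hser : is_series
   (fun k => scal (Cpow (z + h) k - Cpow z k - h * dpow z k : C_AbsRing)%C (b k))
   (minus (minus (power_sum b (z + h)%C) (power_sum b z)) (scal (h : C_AbsRing) l))).
{ assert (A1 := power_sum_correct b (z + h)%C Hb).
  assert (A2 := power_sum_correct b z Hb).
  assert (A3 := @is_series_scal C_AbsRing V (h : C_AbsRing) _ _ Hl).
  assert (A4 := is_series_minus _ _ _ _ (is_series_minus _ _ _ _ A1 A2) A3).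
  revert A4; apply is_series_ext; intros k.
  assert (D : forall x y : C, scal (x - y : C_AbsRing)%C (b k)
      = plus (scal (x : C_AbsRing) (b k)) (opp (scal (y : C_AbsRing) (b k)))).
  { intros x y; exact (@scal_minus_distr_r C_AbsRing V x y (b k)). }
  rewrite D, D; f_equal; f_equal; exact (@scal_assoc C_AbsRing V h (dpow z k) (b k)). }
eapply Rle_trans; [apply (series_norm_le _
  (fun k => (Cmod h) ^ 2 * ((Cmod z + 2) ^ k * norm (b k))) _ Hser) |].
- intros k; rewrite norm_scal_C, <- Rmult_assoc.
  apply Rmult_le_compat_r; [apply norm_ge_0 | apply pow_taylor_bound; lra].
- exact (@ex_series_scal R_AbsRing R_NormedModule _ _ Hc).
- rewrite Series_scal_l; fold S; simpl; rewrite Rmult_1_r.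
  replace (Cmod h * Cmod h * S) with ((Cmod h * S) * Cmod h) by ring.
  apply Rmult_le_compat_r; [exact Hh |].
  apply Rle_trans with (Cmod h * (S + 1)); [nra |].
  replace eps with (eps / (S + 1) * (S + 1)) by (field; lra).
  apply Rmult_le_compat_r; lra.
Qed.

Lemma power_sum_plus b c z : exp_decreasing b -> exp_decreasing c ->
  power_sum (fun k => plus (b k) (c k)) z = plus (power_sum b z) (power_sum c z).
Proof.
intros Hb Hc; apply power_sum_unique.
{ apply (closed_plus _ (exp_decreasing_closed V)); assumption. }
generalize (is_series_plus _ _ _ _ (power_sum_correct b z Hb) (power_sum_correct c z Hc)).
apply is_series_ext; intros k; symmetry; exact (@scal_distr_l C_AbsRing V (Cpow z k) (b k) (c k)).
Qed.

Lemma power_sum_scal (a : C) b z : exp_decreasing b ->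
  power_sum (fun k => scal (a : C_AbsRing) (b k)) z = scal (a : C_AbsRing) (power_sum b z).
Proof.
intros Hb; apply power_sum_unique.
{ apply (closed_scal _ (exp_decreasing_closed V)); exact Hb. }
generalize (@is_series_scal C_AbsRing V (a : C_AbsRing) _ _ (power_sum_correct b z Hb)).
apply is_series_ext; intros k.
transitivity (scal (a * Cpow z k : C_AbsRing)%C (b k)).
- exact (@scal_assoc C_AbsRing V a (Cpow z k) (b k)).
- rewrite Cmult_comm; symmetry; exact (@scal_assoc C_AbsRing V (Cpow z k) a (b k)).
Qed.

End PowerSeries.

(** * Completeness of spaces of sequences and of their retracts *)

Definition graded_cauchy {F : GradedSpace} (u : nat -> F) : Prop :=
  forall n eps, 0 < eps -> exists N : nat, forall i j : nat,
    (N <= i)%nat -> (N <= j)%nat -> gs_norm F n (minus (u i) (u j)) < eps.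

Definition graded_limit {F : GradedSpace} (u : nat -> F) (l : F) : Prop :=
  forall n eps, 0 < eps -> exists N : nat, forall i : nat,
    (N <= i)%nat -> gs_norm F n (minus (u i) l) <= eps.

Lemma ex_series_exp_neg : ex_series (fun k => exp (- INR k)).
Proof.
apply (@ex_series_ext R_AbsRing R_NormedModule (fun k => exp (-1) ^ k)).
- intros k; rewrite <- exp_mult_nat; f_equal; ring.
- apply ex_series_geom; rewrite Rabs_pos_eq by (left; apply exp_pos).
  rewrite <- exp_0; apply exp_increasing; lra.
Qed.

Section SigmaComplete.
Context {W : NormedModule C_AbsRing} (HW : seq_complete W).

Lemma Sigma_norm_minus n (f g : Sigma W) :
  gs_norm (Sigma W) n (minus f g)
   = Series (fun k => exp (INR n * INR k) * norm (minus (proj1_sig f k) (proj1_sig g k))).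
Proof.
simpl; apply Series_ext; intros k; unfold exp_weight; simpl.
f_equal; f_equal; unfold minus; f_equal.
apply (@scal_opp_one C_AbsRing W).
Qed.

Lemma ex_series_weight_minus n (f g : Sigma W) :
  ex_series (fun k => exp (INR n * INR k) * norm (minus (proj1_sig f k) (proj1_sig g k))).
Proof.
generalize (proj2_sig (minus f g) n); apply ex_series_ext; intros k.
unfold exp_weight; simpl; f_equal; f_equal; unfold minus; f_equal.
apply (@scal_opp_one C_AbsRing W).
Qed.

(** One more degree of the weight yields a factor that is summable over [k]. *)
Lemma exp_weight_succ k n : exp (INR n * INR k) = exp (INR (S n) * INR k) * exp (- INR k).
Proof. rewrite <- exp_plus; f_equal; rewrite S_INR; ring. Qed.

(** The terms converge one by one. A bound on the sum with the weight of degree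
    [n + 1] bounds its terms uniformly in [k], and this survives the limit; the
    spare factor e^{-k} sums the bounds up again in degree [n]. *)
Lemma Sigma_complete (u : nat -> Sigma W) : graded_cauchy u -> exists l, graded_limit u l.
Proof.
intros Hu.
assert (Hw : forall n eps, 0 < eps -> exists N : nat, forall i j : nat,
  (N <= i)%nat -> (N <= j)%nat -> forall k,
  exp (INR n * INR k) * norm (minus (proj1_sig (u i) k) (proj1_sig (u j) k)) < eps).
{ intros n eps He; destruct (Hu n eps He) as [N HN]; exists N; intros i j Hi Hj k.
  eapply Rle_lt_trans; [| apply (HN i j Hi Hj)]; rewrite Sigma_norm_minus.
  apply (term_le_Series (fun k => exp (INR n * INR k)
    * norm (minus (proj1_sig (u i) k) (proj1_sig (u j) k)))).
  - intros m; apply Rmult_le_pos; [left; apply exp_pos | apply norm_ge_0].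
  - apply ex_series_weight_minus. }
assert (Hlim : forall k, exists x, norm_limit (fun i => proj1_sig (u i) k) x).
{ intros k; apply HW; intros eps He; destruct (Hw 0%nat eps He) as [N HN].
  exists N; intros i j Hi Hj; generalize (HN i j Hi Hj k).
  simpl INR; rewrite Rmult_0_l, exp_0, Rmult_1_l; auto. }
set (b := fun k => proj1_sig (constructive_indefinite_description _ (Hlim k))).
assert (Hb : forall k, norm_limit (fun i => proj1_sig (u i) k) (b k))
  by (intros k; exact (proj2_sig (constructive_indefinite_description _ (Hlim k)))).
assert (Hbw : forall n eps, 0 < eps -> exists N : nat, forall i : nat, (N <= i)%nat ->
  forall k, exp (INR n * INR k) * norm (minus (proj1_sig (u i) k) (b k)) <= eps).
{ intros n eps He; destruct (Hw n eps He) as [N HN]; exists N; intros i Hi k.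
  assert (Hp := exp_pos (INR n * INR k)); set (p := exp (INR n * INR k)) in *.
  apply le_epsilon; intros d Hd.
  destruct (Hb k (d / p)) as [M HM]; [apply Rdiv_lt_0_compat; lra |].
  set (j := Nat.max N M); specialize (HN i j Hi ltac:(lia) k).
  specialize (HM j ltac:(lia)); fold p in HN; cbv beta in HM.
  apply Rle_trans with (p * (norm (minus (proj1_sig (u i) k) (proj1_sig (u j) k))
     + norm (minus (proj1_sig (u j) k) (b k)))).
  - apply Rmult_le_compat_l; [lra | apply norm_minus_trans].
  - apply (Rmult_lt_compat_l p) in HM; [| exact Hp].
    replace (p * (d / p)) with d in HM by (field; lra).
    rewrite Rmult_plus_distr_l; apply Rplus_le_compat; left; [exact HN | exact HM]. }
assert (Hdom : forall n eps i, (forall k,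
   exp (INR (S n) * INR k) * norm (minus (proj1_sig (u i) k) (b k)) <= eps) ->
   forall k, 0 <= exp (INR n * INR k) * norm (minus (proj1_sig (u i) k) (b k))
     <= eps * exp (- INR k)).
{ intros n eps i H k; split.
  - apply Rmult_le_pos; [left; apply exp_pos | apply norm_ge_0].
  - rewrite exp_weight_succ.
    apply Rle_trans with (exp (INR (S n) * INR k)
      * norm (minus (proj1_sig (u i) k) (b k)) * exp (- INR k)); [right; ring |].
    apply Rmult_le_compat_r; [left; apply exp_pos | apply H]. }
assert (Hexp : exp_decreasing b).
{ intros n; destruct (Hbw (S n) 1 Rlt_0_1) as [N HN].
  apply (ex_series_dominated _ (fun k => exp_weight n (proj1_sig (u N)) k + exp (- INR k))).
  - intros k; split; [apply exp_weight_nonneg |].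
    assert (D := Hdom n 1 N (HN N (Nat.le_refl N)) k).
    unfold exp_weight in *.
    apply Rle_trans with (exp (INR n * INR k) * (norm (proj1_sig (u N) k)
      + norm (minus (proj1_sig (u N) k) (b k)))); [| lra].
    apply Rmult_le_compat_l; [left; apply exp_pos | apply norm_le_minus].
  - apply (@ex_series_plus R_AbsRing R_NormedModule); [apply (proj2_sig (u N)) |].
    apply ex_series_exp_neg. }
exists (exist _ b Hexp : Sigma W); intros n eps He.
set (G := Series (fun k => exp (- INR k))).
assert (HG : 0 <= G).
{ apply Series_nonneg; [intros k; left; apply exp_pos | apply ex_series_exp_neg]. }
destruct (Hbw (S n) (eps / (G + 1))) as [N HN]; [apply Rdiv_lt_0_compat; lra |].
exists N; intros i Hi; rewrite Sigma_norm_minus.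
apply Rle_trans with (Series (fun k => eps / (G + 1) * exp (- INR k))).
- apply Series_le.
  + apply Hdom, HN, Hi.
  + apply (@ex_series_scal R_AbsRing R_NormedModule), ex_series_exp_neg.
- rewrite Series_scal_l; fold G.
  apply Rmult_le_reg_r with (G + 1); [lra |].
  replace (eps / (G + 1) * G * (G + 1)) with (eps * G) by (field; lra). nra.
Qed.

End SigmaComplete.

Lemma linear_minus {F G : ModuleSpace C_AbsRing} (phi : F -> G) : linear_map phi ->
  forall x y, phi (minus x y) = minus (phi x) (phi y).
Proof.
intros [Hp Hs] x y; unfold minus; rewrite Hp; f_equal.
rewrite <- (@scal_opp_one C_AbsRing F y), Hs; apply (@scal_opp_one C_AbsRing G).
Qed.

Lemma linear_zero {F G : ModuleSpace C_AbsRing} (phi : F -> G) : linear_map phi ->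
  phi zero = zero.
Proof.
intros [Hp Hs]; rewrite <- (@scal_zero_l C_AbsRing F zero), Hs.
apply (@scal_zero_l C_AbsRing G).
Qed.

(** Tameness from base degree 0 on. Completeness of a retract requires the estimate
    in all degrees. *)
Definition bounded_with_shift {F G : GradedSpace} (r : nat) (phi : F -> G) : Prop :=
  exists c : nat -> R, (forall n, 0 < c n) /\
    forall n x, gs_norm G n (phi x) <= c n * gs_norm F (n + r) x.

Lemma bounded_tame {F G : GradedSpace} r (phi : F -> G) :
  linear_map phi -> bounded_with_shift r phi -> tame_linear phi.
Proof.
intros Hl [c [Hc Hb]]; split; [exact Hl |].
exists r, 0%nat, c; split; [exact Hc | intros n x _; apply Hb].
Qed.

(** The limit is the image under [psi] of the limit of the images under [phi]. *)
Lemma retract_complete {F G : GradedSpace} r s (phi : F -> G) (psi : G -> F) :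
  (forall u : nat -> G, graded_cauchy u -> exists l, graded_limit u l) ->
  linear_map phi -> bounded_with_shift r phi ->
  linear_map psi -> bounded_with_shift s psi ->
  (forall f, psi (phi f) = f) ->
  forall u : nat -> F, graded_cauchy u -> exists l, graded_limit u l.
Proof.
intros HG Lphi [c [Hc Bphi]] Lpsi [d [Hd Bpsi]] Hid u Hu.
destruct (HG (fun i => phi (u i))) as [l Hl].
- intros n eps He; destruct (Hu (n + r)%nat (eps / c n)) as [N HN];
    [apply Rdiv_lt_0_compat; auto |].
  exists N; intros i j Hi Hj; rewrite <- linear_minus by exact Lphi.
  eapply Rle_lt_trans; [apply Bphi |].
  assert (Hcn := Hc n).
  replace eps with (c n * (eps / c n)) by (field; lra).
  apply Rmult_lt_compat_l; auto.
- exists (psi l); intros n eps He.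
  destruct (Hl (n + s)%nat (eps / d n)) as [N HN]; [apply Rdiv_lt_0_compat; auto |].
  exists N; intros i Hi; rewrite <- (Hid (u i)) at 1.
  rewrite <- linear_minus by exact Lpsi.
  eapply Rle_trans; [apply Bpsi |].
  assert (Hdn := Hd n).
  replace eps with (d n * (eps / d n)) by (field; lra).
  apply Rmult_le_compat_l; [lra | apply HN, Hi].
Qed.

(** * Suprema over annuli *)

Definition Cstar_one : Cstar := exist (fun z => z <> RtoC 0) (RtoC 1) C1_nz.

Section SupNorm.
Context {V : NormedModule C_AbsRing}.

Lemma annulus_one k : annulus k (RtoC 1).
Proof.
unfold annulus; rewrite Cmod_1, <- exp_0; generalize (pos_INR k); intros H.
split; apply exp_le; lra.
Qed.

Lemma sup_norm_lub k (f : Cstar -> V) M :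
  (forall z, annulus k (proj1_sig z) -> norm (f z) <= M) ->
  (forall z, annulus k (proj1_sig z) -> norm (f z) <= sup_norm k f) /\ sup_norm k f <= M.
Proof.
intros HM; unfold sup_norm.
set (E := fun x => exists z : Cstar, annulus k (proj1_sig z) /\ x = norm (f z)).
assert (L := Lub_Rbar_correct E); destruct (Lub_Rbar E) as [l | |].
- destruct L as [L1 L2]; split.
  + intros z Hz; apply (L1 (norm (f z))); exists z; auto.
  + apply (L2 (Finite M)); intros x [z [Hz ->]]; apply HM, Hz.
- exfalso; apply (proj2 L (Finite M)); intros x [z [Hz ->]]; apply HM, Hz.
- exfalso; apply (proj1 L (norm (f Cstar_one))); exists Cstar_one.
  split; [apply annulus_one | reflexivity].
Qed.

Definition bounded_on_annuli (f : Cstar -> V) : Prop :=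
  forall k, exists M, forall z, annulus k (proj1_sig z) -> norm (f z) <= M.

Lemma sup_norm_ub k (f : Cstar -> V) (z : Cstar) : bounded_on_annuli f ->
  annulus k (proj1_sig z) -> norm (f z) <= sup_norm k f.
Proof. intros Hf; destruct (Hf k) as [M HM]; apply (proj1 (sup_norm_lub k f M HM)). Qed.

Lemma sup_norm_le k (f : Cstar -> V) M :
  (forall z, annulus k (proj1_sig z) -> norm (f z) <= M) -> sup_norm k f <= M.
Proof. intros HM; apply (sup_norm_lub k f M HM). Qed.

Lemma sup_norm_nonneg k (f : Cstar -> V) : bounded_on_annuli f -> 0 <= sup_norm k f.
Proof.
intros Hf; apply Rle_trans with (norm (f Cstar_one)); [apply norm_ge_0 |].
apply (sup_norm_ub k f Cstar_one Hf); apply annulus_one.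
Qed.

Lemma sup_norm_seminorm k : (forall f : Hol V, bounded_on_annuli (proj1_sig f)) ->
  is_seminorm (gs_norm (Hol V) k).
Proof.
intros HB; split; [| split]; simpl.
- intros f; apply sup_norm_nonneg, HB.
- intros f g; apply sup_norm_le; intros z Hz; simpl.
  eapply Rle_trans; [apply norm_triangle |].
  apply Rplus_le_compat; apply sup_norm_ub; auto.
- assert (Hle : forall (a : C) (f : Hol V),
    sup_norm k (proj1_sig (fs_scal holomorphic (holomorphic_closed V) (a : C_AbsRing) f))
      <= Cmod a * sup_norm k (proj1_sig f)).
  { intros a f; apply sup_norm_le; intros z Hz; simpl; rewrite norm_scal_C.
    apply Rmult_le_compat_l; [apply Cmod_ge_0 | apply sup_norm_ub; auto]. }
  intros a f; apply Rle_antisym; [apply Hle |].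
  destruct (Ceq_dec a 0) as [-> | Ha].
  { rewrite Cmod_0, Rmult_0_l; apply sup_norm_nonneg.
    apply (HB (fs_scal holomorphic (holomorphic_closed V) (RtoC 0 : C_AbsRing) f)). }
  assert (Hm : 0 < Cmod a) by (apply Cmod_gt_0; exact Ha).
  apply Rmult_le_reg_l with (/ Cmod a); [apply Rinv_0_lt_compat, Hm |].
  rewrite <- Rmult_assoc, Rinv_l, Rmult_1_l by lra.
  rewrite <- Cmod_inv by exact Ha.
  eapply Rle_trans; [| apply (Hle (/ a)%C
    (fs_scal holomorphic (holomorphic_closed V) (a : C_AbsRing) f))].
  right; f_equal; apply functional_extensionality; intros z; simpl.
  rewrite (@scal_assoc C_AbsRing V).
  replace (mult (/ a : C_AbsRing)%C (a : C_AbsRing)) with (@one C_AbsRing);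
    [symmetry; apply (@scal_one C_AbsRing V) |].
  symmetry; exact (Cinv_l a Ha).
Qed.

End SupNorm.

Lemma extend0_at {V : NormedModule C_AbsRing} (f : Cstar -> V) (z : Cstar) :
  extend0 f (proj1_sig z) = f z.
Proof.
destruct z as [z Hz]; unfold extend0; simpl; destruct (Ceq_dec z (RtoC 0)) as [E | H].
- elim Hz; exact E.
- f_equal; f_equal; apply ProofIrrelevance.proof_irrelevance.
Qed.

(** * Holomorphic maps as a retract of a space of sequences *)

Section Retract.
Context {V : NormedModule C_AbsRing} (HV : seq_complete V).

Let HW := prod_seq_complete V V HV HV.
(** The Banach space of pairs (a_k, a_{-k}): keeping the two coefficients of the
    same absolute index together, rather than interleaving them, gives both of
    them the weight e^{nk}. *)
Definition coef_space : CompleteNormedModule C_AbsRing :=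
  complete_module (prod_NormedModule C_AbsRing V V) HW.

Lemma exp_decreasing_pair (b : nat -> V * V) :
  @exp_decreasing coef_space b ->
  exp_decreasing (fun k => fst (b k)) /\ exp_decreasing (fun k => snd (b k)).
Proof.
intros Hb; split; intros n; (eapply ex_series_dominated; [| apply (Hb n)]);
 intros k; (split; [apply exp_weight_nonneg |]); unfold exp_weight;
 (apply Rmult_le_compat_l; [left; apply exp_pos |]).
- eapply Rle_trans; [apply Rmax_l | apply (norm_prod (fst (b k)) (snd (b k)))].
- eapply Rle_trans; [apply Rmax_r | apply (norm_prod (fst (b k)) (snd (b k)))].
Qed.

Definition synth_fun (b : nat -> V * V) (z : C) : V :=
  plus (power_sum (fun k => fst (b k)) z) (power_sum (fun k => snd (b k)) (/ z)).

Lemma synth_holomorphic (b : Sigma coef_space) :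
  holomorphic (fun z : Cstar => synth_fun (proj1_sig b) (proj1_sig z)).
Proof.
destruct b as [b Hb]; simpl; destruct (exp_decreasing_pair b Hb) as [H1 H2].
intros [z Hz]; simpl.
apply (@ex_derive_ext_loc C_AbsRing V (synth_fun b)).
- exists (mkposreal _ (proj1 (Cmod_gt_0 z) Hz)); intros w Hw.
  change (Cmod (w - z) < Cmod z) in Hw.
  unfold extend0; destruct (Ceq_dec w (RtoC 0)) as [-> | H]; [| reflexivity].
  exfalso; rewrite <- Cmod_opp in Hw.
  replace (- (0 - z))%C with z in Hw by ring; lra.
- apply (@ex_derive_plus C_AbsRing V).
  + apply power_sum_derivable; assumption.
  + apply (@ex_derive_comp C_AbsRing V _ Cinv).
    * apply power_sum_derivable; assumption.
    * eexists; apply is_derive_Cinv, Hz.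
Qed.

Definition synth (b : Sigma coef_space) : Hol V :=
  exist holomorphic _ (synth_holomorphic b).

Lemma synth_linear : linear_map synth.
Proof.
split.
- intros [b Hb] [c Hc]; apply fs_ext; intros z; simpl; unfold synth_fun.
  destruct (exp_decreasing_pair b Hb) as [B1 B2], (exp_decreasing_pair c Hc) as [C1 C2].
  simpl.
  rewrite (power_sum_plus HV (fun k => fst (b k)) (fun k => fst (c k))) by assumption.
  rewrite (power_sum_plus HV (fun k => snd (b k)) (fun k => snd (c k))) by assumption.
  rewrite <- !plus_assoc; f_equal; rewrite !plus_assoc; f_equal; apply plus_comm.
- intros a [b Hb]; apply fs_ext; intros z; simpl; unfold synth_fun.
  destruct (exp_decreasing_pair b Hb) as [B1 B2]; simpl.
  rewrite (power_sum_scal HV a (fun k => fst (b k))) by assumption.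
  rewrite (power_sum_scal HV a (fun k => snd (b k))) by assumption.
  symmetry; apply (@scal_distr_l C_AbsRing V).
Qed.

Lemma synth_bound (b : Sigma coef_space) k (z : Cstar) : annulus k (proj1_sig z) ->
  norm (proj1_sig (synth b) z) <= 2 * gs_norm (Sigma coef_space) k b.
Proof.
destruct b as [b Hb], z as [z Hz]; simpl; intros [A1 A2].
destruct (exp_decreasing_pair b Hb) as [B1 B2].
assert (Hm : 0 < Cmod z) by (apply Cmod_gt_0; exact Hz).
assert (Hi : Cmod (/ z) <= exp (INR k)).
{ rewrite Cmod_inv by exact Hz; rewrite <- (Rinv_inv (exp (INR k))), <- exp_Ropp.
  apply Rinv_le_contravar; [apply exp_pos | exact A1]. }
unfold synth_fun; eapply Rle_trans; [apply norm_triangle |].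
assert (L : forall c : nat -> V, exp_decreasing c ->
  (forall j, norm (c j) <= @norm _ coef_space (b j)) ->
  Series (exp_weight k c) <= Series (@exp_weight coef_space k b)).
{ intros c Hc Hcb; apply Series_le; [| apply Hb]; intros j.
  split; [apply exp_weight_nonneg |].
  apply Rmult_le_compat_l; [left; apply exp_pos | apply Hcb]. }
generalize (power_sum_bound HV _ z k B1 A2), (power_sum_bound HV _ _ k B2 Hi).
assert (L1 := L _ B1 (fun j => Rle_trans _ _ _ (Rmax_l _ _)
   (proj1 (norm_prod (fst (b j)) (snd (b j)))))).
assert (L2 := L _ B2 (fun j => Rle_trans _ _ _ (Rmax_r _ _)
   (proj1 (norm_prod (fst (b j)) (snd (b j)))))).
lra.
Qed.

Lemma synth_shift : bounded_with_shift 0 synth.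
Proof.
exists (fun _ => 2); split; [intros; lra |]; intros n b; rewrite Nat.add_0_r.
apply sup_norm_le; intros z Hz; apply synth_bound, Hz.
Qed.

Context (K : R) (A : (C -> V) -> Z -> V) (HA : laurent_operator K A).

Lemma hol_derivable (f : Hol V) : derivable_off_0 (extend0 (proj1_sig f)).
Proof. intros z Hz; apply (proj2_sig f (exist _ z Hz)). Qed.

Definition coefs (f : Cstar -> V) (k : nat) : V * V :=
  (A (extend0 f) (Z.of_nat k), neg_part (A (extend0 f)) k).

Lemma neg_part_norm (a : Z -> V) k M : 0 <= M ->
  norm (a (- Z.of_nat k)%Z) <= M -> norm (neg_part a k) <= M.
Proof.
intros HM H; destruct k; [| exact H]; simpl.
apply Rle_trans with 0; [right; exact (@norm_zero _ V) | exact HM].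
Qed.

(** Cauchy's estimate on the outer circle for a_k and on the inner one for a_{-k}. *)
Lemma coefs_bound (f : Hol V) n M :
  (forall z, Cmod z = exp (INR (S n)) \/ Cmod z = exp (- INR (S n)) ->
     norm (extend0 (proj1_sig f) z) <= M) ->
  forall k, @exp_weight coef_space n (coefs (proj1_sig f)) k
    <= sqrt 2 * K * M * exp (- INR k).
Proof.
intros HM k; assert (HK := lo_pos _ _ HA).
assert (HM0 : 0 <= M).
{ apply Rle_trans with (norm (extend0 (proj1_sig f) (cexp (RtoC (INR (S n))))));
   [apply norm_ge_0 | apply HM; left; apply Cmod_cexp]. }
assert (B1 : norm (fst (coefs (proj1_sig f) k)) <= K * exp (- INR k * INR (S n)) * M).
{ unfold coefs; simpl fst; rewrite (INR_IZR_INZ k).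
  apply (lo_bound _ _ HA); [apply hol_derivable | intros z Hz; apply HM; auto]. }
assert (B2 : norm (snd (coefs (proj1_sig f) k)) <= K * exp (- INR k * INR (S n)) * M).
{ unfold coefs; simpl snd; apply neg_part_norm.
  - repeat apply Rmult_le_pos; try lra; left; apply exp_pos.
  - replace (- INR k * INR (S n)) with (- IZR (- Z.of_nat k) * (- INR (S n)))
      by (rewrite opp_IZR, <- INR_IZR_INZ; ring).
    apply (lo_bound _ _ HA); [apply hol_derivable | intros z Hz; apply HM; auto]. }
unfold exp_weight.
apply Rle_trans with (exp (INR n * INR k) * (sqrt 2 * (K * exp (- INR k * INR (S n)) * M))).
- apply Rmult_le_compat_l; [left; apply exp_pos |].
  eapply Rle_trans.
  { apply (norm_prod (fst (coefs (proj1_sig f) k)) (snd (coefs (proj1_sig f) k))). }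
  apply Rmult_le_compat_l; [apply sqrt_pos | apply Rmax_lub; assumption].
- right; rewrite exp_weight_succ.
  replace (exp (- INR k * INR (S n))) with (/ exp (INR (S n) * INR k)).
  + assert (H := exp_pos (INR (S n) * INR k)); field; lra.
  + rewrite <- exp_Ropp; f_equal; ring.
Qed.

(** An a priori bound on each single circle is enough to see that the coefficients
    decrease exponentially; boundedness on whole annuli then follows in
    [hol_bounded]. *)
Lemma circle_bounded (f : Hol V) x : exists M, forall z, Cmod z = exp x ->
  norm (extend0 (proj1_sig f) z) <= M.
Proof.
destruct (@bounded_continuity C_AbsRing V
  (fun t => extend0 (proj1_sig f) (cexp (RtoC x + imag t))) (- PI) PI) as [M HM].
- intros t _; apply (@continuous_comp R_UniformSpace CN V
    (fun t => cexp (RtoC x + imag t)) (extend0 (proj1_sig f))).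
  + apply continuous_ext with (2 := path_cexp_line 1 (RtoC x) t); intros s; f_equal; ring.
  + apply (@ex_derive_continuous C_AbsRing V), hol_derivable, cexp_neq_0.
- exists M; intros z Hz.
  destruct (cexp_surj z) as [w [<- Hw]].
  { apply Cmod_gt_0; rewrite Hz; apply exp_pos. }
  rewrite Cmod_cexp in Hz; apply exp_inv in Hz.
  left; replace w with (RtoC x + imag (Im w))%C; [apply HM, Hw |].
  destruct w as [p q]; simpl in *; subst; apply injective_projections; simpl; ring.
Qed.

Lemma coefs_exp_decreasing (f : Hol V) : @exp_decreasing coef_space (coefs (proj1_sig f)).
Proof.
intros n; destruct (circle_bounded f (INR (S n))) as [M1 H1],
  (circle_bounded f (- INR (S n))) as [M2 H2].
apply (ex_series_dominated _ (fun k => sqrt 2 * K * Rmax M1 M2 * exp (- INR k))).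
- intros k; split; [apply exp_weight_nonneg | apply coefs_bound].
  intros z [Hz | Hz]; [eapply Rle_trans; [apply H1, Hz | apply Rmax_l] |
    eapply Rle_trans; [apply H2, Hz | apply Rmax_r]].
- apply (@ex_series_scal R_AbsRing R_NormedModule), ex_series_exp_neg.
Qed.

Definition analysis (f : Hol V) : Sigma coef_space :=
  exist (@exp_decreasing coef_space) _ (coefs_exp_decreasing f).

Lemma synth_analysis f : synth (analysis f) = f.
Proof.
apply fs_ext; intros z; simpl; unfold synth_fun.
destruct (exp_decreasing_pair _ (coefs_exp_decreasing f)) as [B1 B2].
assert (S := is_series_plus _ _ _ _ (power_sum_correct HV _ (proj1_sig z) B1)
  (power_sum_correct HV _ (/ proj1_sig z)%C B2)).
etransitivity; [| apply (extend0_at (proj1_sig f) z)].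
apply (series_unique _ _ _ S), (lo_series _ _ HA); [apply hol_derivable | apply (proj2_sig z)].
Qed.

Lemma hol_bounded (f : Hol V) : bounded_on_annuli (proj1_sig f).
Proof.
intros k; exists (2 * gs_norm (Sigma coef_space) k (analysis f)); intros z Hz.
rewrite <- (synth_analysis f) at 1; apply synth_bound, Hz.
Qed.

Lemma norm_extend0_le (f : Hol V) k z : annulus k z ->
  norm (extend0 (proj1_sig f) z) <= sup_norm k (proj1_sig f).
Proof.
intros Hz; assert (Hz0 : z <> RtoC 0).
{ apply Cmod_gt_0; eapply Rlt_le_trans; [apply exp_pos | apply Hz]. }
eapply Rle_trans; [right; exact (f_equal norm (extend0_at (proj1_sig f) (exist _ z Hz0))) |].
apply (sup_norm_ub k _ (exist _ z Hz0)); [apply hol_bounded | exact Hz].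
Qed.

Lemma analysis_shift : bounded_with_shift 1 analysis.
Proof.
set (G := Series (fun k => exp (- INR k))).
assert (HG : 0 <= G).
{ apply Series_nonneg; [intros k; left; apply exp_pos | apply ex_series_exp_neg]. }
assert (HK := lo_pos _ _ HA).
assert (Hs : 0 < sqrt 2) by (apply sqrt_lt_R0; lra).
exists (fun _ => sqrt 2 * K * (G + 1)); split.
{ intros _; repeat apply Rmult_lt_0_compat; lra. }
intros n f; rewrite Nat.add_1_r; set (M := gs_norm (Hol V) (S n) f).
assert (HM : 0 <= M) by apply sup_norm_nonneg, hol_bounded.
assert (B : forall k, @exp_weight coef_space n (coefs (proj1_sig f)) k
    <= sqrt 2 * K * M * exp (- INR k)).
{ apply coefs_bound; intros z Hz; apply norm_extend0_le; unfold annulus.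
  assert (exp (- INR (S n)) <= exp (INR (S n)))
    by (apply exp_le; generalize (pos_INR (S n)); lra).
  destruct Hz as [-> | ->]; lra. }
apply Rle_trans with (Series (fun k => sqrt 2 * K * M * exp (- INR k))).
- apply Series_le.
  + intros k; split; [apply exp_weight_nonneg | apply B].
  + apply (@ex_series_scal R_AbsRing R_NormedModule), ex_series_exp_neg.
- rewrite Series_scal_l; fold G.
  replace (sqrt 2 * K * (G + 1) * M) with (sqrt 2 * K * M * (G + 1)) by ring.
  apply Rmult_le_compat_l; [| lra].
  repeat apply Rmult_le_pos; lra.
Qed.

Lemma analysis_linear : linear_map analysis.
Proof.
split.
- intros f g; apply fs_ext; intros k.
  assert (P : forall m, A (extend0 (proj1_sig (plus f g : Hol V))) m
    = plus (A (extend0 (proj1_sig f)) m) (A (extend0 (proj1_sig g)) m)).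
  { intros m; rewrite <- (lo_plus _ _ HA) by apply hol_derivable.
    f_equal; apply functional_extensionality; intros z; unfold extend0.
    destruct (Ceq_dec z (RtoC 0)); [symmetry; apply plus_zero_r | reflexivity]. }
  apply injective_projections; [apply P |].
  destruct k; [symmetry; apply plus_zero_r | apply P].
- intros a f; apply fs_ext; intros k.
  assert (P : forall m, A (extend0 (proj1_sig (scal a f : Hol V))) m
    = scal a (A (extend0 (proj1_sig f)) m)).
  { intros m; rewrite <- (lo_scal _ _ HA) by apply hol_derivable.
    f_equal; apply functional_extensionality; intros z; unfold extend0.
    destruct (Ceq_dec z (RtoC 0)); [symmetry; apply (@scal_zero_r C_AbsRing V) | reflexivity]. }
  apply injective_projections; [apply P |].
  destruct k; [symmetry; apply (@scal_zero_r C_AbsRing V) | apply P].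
Qed.

(** The unit circle belongs to every annulus, and Cauchy's estimate on it makes all
    the coefficients vanish. *)
Lemma sup_norm_eq_0 k (f : Hol V) : gs_norm (Hol V) k f = 0 -> f = zero.
Proof.
intros Hf.
assert (Hz : forall m, A (extend0 (proj1_sig f)) m = zero).
{ intros m; apply norm_eq_zero, Rle_antisym; [| apply norm_ge_0].
  apply Rle_trans with (K * exp (- IZR m * 0) * 0); [| right; ring].
  apply (lo_bound _ _ HA); [apply hol_derivable |]; intros z Hz.
  rewrite <- Hf; apply norm_extend0_le; unfold annulus; rewrite Hz.
  split; apply exp_le; generalize (pos_INR k); lra. }
rewrite <- (synth_analysis f), <- (linear_zero synth synth_linear); f_equal.
apply fs_ext; intros k'; simpl; unfold coefs; rewrite Hz.
destruct k'; simpl; rewrite ?Hz; reflexivity.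
Qed.

Lemma Hol_frechet : graded_frechet (Hol V).
Proof.
split.
- intros n; apply sup_norm_seminorm; intros f; apply hol_bounded.
- intros n f; apply sup_norm_le; intros z [Z1 Z2]; apply sup_norm_ub; [apply hol_bounded |].
  unfold annulus; rewrite S_INR.
  assert (exp (- (INR n + 1)) <= exp (- INR n)) by (apply exp_le; lra).
  assert (exp (INR n) <= exp (INR n + 1)) by (apply exp_le; lra). lra.
- intros f Hf; apply (sup_norm_eq_0 0), Hf.
- intros u Hu.
  destruct (retract_complete 1 0 analysis synth (Sigma_complete (W := coef_space) HW)
    analysis_linear analysis_shift synth_linear synth_shift synth_analysis u Hu) as [l Hl].
  exists l; intros n; apply is_lim_seq_spec; intros eps.
  assert (He := cond_pos eps).
  destruct (Hl n (eps / 2)) as [N HN]; [lra |]; exists N; intros i Hi.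
  assert (P : 0 <= gs_norm (Hol V) n (minus (u i) l)).
  { apply sup_norm_nonneg, hol_bounded. }
  rewrite Rminus_0_r, Rabs_pos_eq by exact P; specialize (HN i Hi); lra.
Qed.

End Retract.

Theorem theorem3p13 (n : nat) (V : NormedModule C_AbsRing) (hV : has_dim V n) :
  (forall k : nat, is_norm (gs_norm (Hol V) k)) /\ tame_frechet (Hol V).
Proof.
assert (HV := finite_dim_complete n hV).
destruct (laurent_operator_finite_dim V n hV) as [K [A HA]].
assert (HF := Hol_frechet HV K A HA).
split.
- intros k; split; [apply HF | intros f; apply (sup_norm_eq_0 HV K A HA)].
- split; [exact HF |].
  exists (coef_space HV), (analysis HV K A HA), (synth HV); split; [| split].
  + apply (bounded_tame 1); [apply analysis_linear | apply analysis_shift].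
  + apply (bounded_tame 0); [apply synth_linear | apply synth_shift].
  + apply synth_analysis.
Qed.
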